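(* Let $\alpha\ge-1/2$ and let $\nu,\mu\in\mathbb{R}$ be such that $0<\mu+\nu\le\alpha+3/2$. Let $f:\mathbb{R}_+\to\mathbb{C}$ be such that $t^{\nu}f(t)\in L^1(0,1)$. If the conditions $$|f(M)|=o\big(M^{\mu-1}\big)\quad\text{as }M\to\infty,$$ $$\int_M^\infty t^{\nu-\alpha-1/2}\,|df(t)|=o\big(M^{\mu+\nu-\alpha-3/2}\big)\quad\text{as }M\to\infty$$ are satisfied, then $\mathcal{L}^{\alpha}_{\nu,\mu}f$ converges uniformly on $\mathbb{R}_+$.
   Context: $\mathbb{R}_+=[0,\infty)$. For $\alpha\ge-1/2$, $j_\alpha(z)=\Gamma(\alpha+1)(z/2)^{-\alpha}J_\alpha(z)$ is the normalized Bessel function, where $J_\alpha$ is the Bessel function of the first kind of order $\alpha$ (so $j_\alpha(0)=1$). Standing assumption: $f:\mathbb{R}_+\to\mathbb{C}$ is locally of bounded variation and locally integrable on $(0,\infty)$. Integrals against $|df(t)|$ are Stieltjes integrals with respect to the total variation of $f$. The transform is $\mathcal{L}^{\alpha}_{\nu,\mu}f(r)=r^\mu\int_0^\infty (rt)^\nu f(t)j_\alpha(rt)\,dt$, where $\int_0^\infty=\lim_{N\to\infty}\int_0^N$ and $r^\mu(rt)^\nu$ is read as $r^{\mu+\nu}t^\nu$ (so when $\mu+\nu>0$ the partial integrals are $0$ at $r=0$). It converges uniformly on a set $E\subset\mathbb{R}_+$ if the partial integrals $r^{\mu}\int_0^N (rt)^\nu f(t)j_\alpha(rt)\,dt$ converge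 uniformly in $r\in E$ as $N\to\infty$, equivalently $r^{\mu}\int_M^N (rt)^\nu f(t)j_\alpha(rt)\,dt\to0$ uniformly in $r\in E$ as $N>M\to\infty$. *)

(* Defs.v *)
From HB Require Import structures.
From mathcomp Require Import all_boot all_order all_algebra.
From mathcomp Require Import all_classical all_reals all_analysis.
From mathcomp Require Import complex.

Set Implicit Arguments.
Unset Strict Implicit.
Unset Printing Implicit Defensive.

Import Order.TTheory GRing.Theory Num.Theory.
Import numFieldNormedType.Exports.
Import ComplexField.Normc.

Local Open Scope classical_set_scope.
Local Open Scope complex_scope.
Local Open Scope ring_scope.

(* Registers the filter at +oo for the library's Landau notations. *)
Canonical pinfty_filter_on (R : realType) : filter_on R :=
  FilterType (pinfty_nbhs R) (@filter_filter R _ (@proper_pinfty_nbhs R)).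

Section Bessel.
Context {R : realType}.
Implicit Types (x z alpha : R).

(* Euler's integral, so the Gamma function only for 0 < x. *)
Definition Gamma x : R :=
  \int[lebesgue_measure]_(t in `]0, +oo[) (t `^ (x - 1) * expR (- t)).

(* Intended for 0 < z and -1 < alpha: then Gamma is only used on positive
   arguments, and z / 2 is a legitimate base for real powers. *)
Definition besselJ alpha z : R :=
  limn (series (fun k : nat =>
    (-1) ^+ k / (k`!%:R * Gamma (k%:R + alpha + 1))
      * (z / 2) `^ (2 * k%:R + alpha))).

(* The formula is singular at z = 0, where the value is set by continuity. *)
Definition besselj alpha z : R :=
  if z == 0 then 1
  else Gamma (alpha + 1) * (z / 2) `^ (- alpha) * besselJ alpha z.

End Bessel.

(* Functions R_+ -> C are represented by functions R -> R[i] of which only the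
   values on [0, +oo[ are used; [normc] is the modulus with values in R. *)
Section ComplexValued.
Context {R : realType}.
Implicit Types (a b : R) (f : R -> R[i]) (D : set R).

Definition cintegrable D f : Prop :=
  lebesgue_measure.-integrable D (fun t => (complex.Re (f t))%:E) /\
  lebesgue_measure.-integrable D (fun t => (complex.Im (f t))%:E).

Definition clocally_integrable D f : Prop :=
  locally_integrable D (fun t => complex.Re (f t)) /\
  locally_integrable D (fun t => complex.Im (f t)).

Definition cintegral D f : R[i] :=
  (\int[lebesgue_measure]_(t in D) complex.Re (f t)) +i*
  (\int[lebesgue_measure]_(t in D) complex.Im (f t)).

(* [variation], [variations], [bounded_variation] and [total_variation] of the
   library are for real-valued functions; these are their complex versions. *)
Definition cvariation a b f (s : seq R) : R :=
  let F := f \o nth b (a :: s) in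
  \sum_(0 <= n < size s) normc (F n.+1 - F n).

Definition cvariations a b f : set R :=
  [set cvariation a b f s | s in itv_partition a b].

Definition cbounded_variation a b f : Prop := has_ubound (cvariations a b f).

Definition ctotal_variation a b f : \bar R :=
  ereal_sup [set x%:E | x in cvariations a b f].

Definition clocally_BV_pos f : Prop :=
  forall a b, 0 < a -> a < b -> cbounded_variation a b f.

End ComplexValued.

Section Stieltjes.
Context {R : realType}.
Implicit Types (a b : R) (g V : R -> R).

(* Points of a partition of [a, b] are a :: s, and xi lists the tags. *)
Definition RS_sum a b g V (s xi : seq R) : R :=
  let x := nth b (a :: s) in
  \sum_(0 <= n < size s) g (nth b xi n) * (V (x n.+1) - V (x n)).

Definition is_RS_integral a b g V (I : R) : Prop :=
  forall e : R, 0 < e -> exists2 d : R, 0 < d &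
    forall s xi : seq R, itv_partition a b s ->
      let x := nth b (a :: s) in
      (forall n, (n < size s)%N ->
         x n.+1 - x n < d /\ x n <= nth b xi n <= x n.+1) ->
      `|RS_sum a b g V s xi - I| < e.

Definition RS_integral a b g V : R := get (is_RS_integral a b g V).

(* The integral of g |df| over [a, b] and over [a, +oo[: Riemann-Stieltjes with
   respect to the total variation function of f. *)
Definition variation_integral a b g (f : R -> R[i]) : R :=
  RS_integral a b g (fun t => fine (ctotal_variation a t f)).

Definition variation_integral_infty a g (f : R -> R[i]) : \bar R :=
  lim ((variation_integral a b g f)%:E @[b --> +oo]).

End Stieltjes.

Section HankelTransform.
Context {R : realType}.
Implicit Types (alpha nu mu r N : R) (f : R -> R[i]).

(* r^mu (r t)^nu is read as r^(mu + nu) t^nu; recall 0 `^ p = 0 for p != 0.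
   The codomain is R[i]^o because that is where the library puts the usual
   topology of the complex numbers. *)
Definition hankel_partial alpha nu mu f N r : R[i]^o :=
  (r `^ (mu + nu))%:C *
  cintegral `[0, N] (fun t => (t `^ nu)%:C * f t * (besselj alpha (r * t))%:C).

Definition hankel_transform alpha nu mu f r : R[i]^o :=
  lim (hankel_partial alpha nu mu f N r @[N --> +oo]).

Definition hankel_converges_uniformly alpha nu mu f (E : set R) : Prop :=
  {uniform E, hankel_partial alpha nu mu f @ +oo
              --> hankel_transform alpha nu mu f}.

End HankelTransform.

(* Main.v *)
(** An interval [[M, N]] of integration is split at [1 / r]. For [t <= 1 / r] one
    uses [|j| <= 1] and [|f t| <= eps t^(mu - 1)], which is integrable against
    [t^nu] near [0] because [0 < mu + nu]. For [1 / r <= t], Bessel's equation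
    [j'' + (2 alpha + 1) / z j' + j = 0] shows that, with
    [kappa = nu - 2 alpha - 1], the function
      [H t = - t^nu j'(r t) / r + kappa t^(nu - 1) j(r t) / r^2]
    is a primitive of [t^nu j(r t)] up to the error
    [kappa (nu - 1) t^(nu - 2) j(r t) / r^2]. Since [j] and [j'] are
    [O(z^(- alpha - 1/2))], integrating by parts against [df] bounds the main
    term by the two hypotheses, and the error term gains the factor [(r t)^-2],
    which makes it absolutely integrable. *)

Require Import Defs.
From HB Require Import structures.
From mathcomp Require Import all_boot all_order all_algebra.
From mathcomp Require Import all_classical all_reals all_analysis.
From mathcomp Require Import complex.
From mathcomp Require Import measurable_realfun ring lra.

Set Implicit Arguments.
Unset Strict Implicit.
Unset Printing Implicit Defensive.

Import Order.TTheory GRing.Theory Num.Theory.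
Import numFieldNormedType.Exports.
Import ComplexField.Normc.

Local Open Scope classical_set_scope.
Local Open Scope complex_scope.
Local Open Scope ring_scope.

(** * Primitives and the Gamma function *)

(** The point is that [r] must vanish from every bound. With [q = alpha + 1/2], the boundary and
    Stieltjes terms over [[a, b]], [a >= 1/r], come out as [eps] times [(r a)^(mu + nu - q - 1)];
    the upper bound on [mu + nu] makes this exponent nonpositive, so the power is at most 1. The
    error term has exponent lower by one, which also keeps the denominator in its integral away from
    0. The decay of [j] and [j'] is drawn from the differential equation alone, by an energy
    argument. The equation comes from the power series in [w = (z/2)^2], and the functional equation
    of [Gamma] is what turns the coefficients of [besselJ] into products of the factors [alpha + i].
    Since [f] may jump, integration by parts is done on Riemann sums: on a partition of mesh [d] its
    error is at most [2 K d] times the variation, hence disappears as [d] tends to 0. The same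
    estimate shows that the Stieltjes integrals against the total variation exist. *)

Lemma is_derive_continuous (R : realType) (F : R -> R) (x d : R) :
  is_derive x 1 F d -> {for x, continuous F}.
Proof. by case=> dF _; exact/differentiable_continuous/derivable1_diffP. Qed.

Lemma in_itv_within_continuous (R : realType) (F : R -> R) (i : interval R) :
  {in i, continuous F} -> {within [set` i], continuous F}.
Proof.
by move=> cF; apply: continuous_in_subspaceT => x; rewrite inE => /cF.
Qed.

Lemma continuous_itv_integrable (R : realType) (f : R -> R) (a b : R) :
  {in `[a, b], continuous f} ->
  lebesgue_measure.-integrable `[a, b] (EFin \o f).
Proof.
move=> cf; apply: continuous_compact_integrable; first exact: segment_compact.
exact: in_itv_within_continuous.
Qed.

Lemma is_derive_FTC2 (R : realType) (F f : R -> R) (a b : R) : a <= b ->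
  {in `[a, b], forall t : R, is_derive t 1 F (f t)} ->
  {in `[a, b], continuous f} ->
  \int[lebesgue_measure]_(t in `[a, b]) f t = F b - F a.
Proof.
rewrite le_eqVlt => /predU1P[<- _ _|ab dF cf].
  by rewrite set_itv1 Rintegral_set1 subrr.
have cF x : x \in `[a, b] -> {for x, continuous F}.
  by move=> /dF; exact: is_derive_continuous.
rewrite /Rintegral (@continuous_FTC2 _ f F)//.
- exact: in_itv_within_continuous.
- split.
  + by move=> x /subset_itv_oo_cc /dF[].
  + by apply: cvg_at_right_filter; apply: cF; rewrite in_itv/= lexx ltW.
  + by apply: cvg_at_left_filter; apply: cF; rewrite in_itv/= lexx ltW.
- by move=> x /subset_itv_oo_cc /dF[_ <-]; rewrite derive1E.
Qed.

Lemma continuous_powR (R : realType) (a x : R) : 0 < x ->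
  {for x, continuous (fun t : R => t `^ a)}.
Proof. by move=> x0; exact: (@is_derive_continuous _ _ _ _ (is_derive1_powR a x0)). Qed.

Lemma cvgn_powR_expRN (R : realType) (x : R) : 0 <= x ->
  n.+1%:R `^ x * expR (- n.+1%:R : R) @[n --> \oo] --> 0.
Proof.
(* For [m >= x] and [y = n + 1], the bound [exp y >= 1 + y^(m+1) / (m+1)!] gives
   [y^x exp(-y) <= (m+1)! / y]. *)
move=> x0; have [m xm] : exists m : nat, x <= m%:R.
  by exists (Num.truncn x).+1; rewrite ltW// truncnS_gt.
apply: (@squeeze_cvgr _ _ _ _ (fun=> 0) (fun n => m.+1`!%:R * n.+1%:R^-1)).
- near=> n; rewrite mulr_ge0 ?powR_ge0 ?expR_ge0//=.
  have n0 : (0 : R) < n.+1%:R by rewrite ltr0n.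
  rewrite expRN ler_pdivrMr ?expR_gt0//.
  rewrite (@le_trans _ _ (n.+1%:R ^+ m))//.
    by rewrite -powR_mulrn ?ler0n// ler_powR// ler1n.
  rewrite -mulrA mulrC -ler_pdivrMr ?ltr0n ?fact_gt0//.
  rewrite [leRHS]mulrC ler_pdivlMr// mulrAC -exprSr.
  apply: le_trans (expR_ge1Dxn m (ltW n0)).
  by rewrite lerDr.
- exact: cvg_cst.
- rewrite -[X in _ --> X](mulr0 m.+1`!%:R); apply: cvgMr.
  exact: cvg_harmonic.
Unshelve. all: by end_near. Qed.

Lemma cvgn_powR_harmonic (R : realType) (x : R) : 0 < x ->
  (n.+1%:R : R)^-1 `^ x @[n --> \oo] --> 0.
Proof.
move=> x0; have /cvg_at_rightP := powR_cvg0 x0; apply; split.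
  by move=> n; rewrite invr_gt0.
exact: cvg_harmonic.
Qed.

Lemma bigcup_itv_invn_n (R : realType) :
  \bigcup_n `[(n.+1%:R : R)^-1, n.+1%:R]%classic = `]0, +oo[%classic.
Proof.
apply/seteqP; split=> [x [n _]|x]/=; rewrite !in_itv/= andbT.
  by move=> /andP[nx _]; rewrite (lt_le_trans _ nx)// invr_gt0.
move=> x0; exists (maxn (Num.truncn x) (Num.truncn x^-1)) => //=.
have le_max (y : R) k : (Num.truncn y <= k)%N -> y <= k.+1%:R.
  move=> yk; rewrite (le_trans (ltW (truncnS_gt y)))// ler_nat ltnS//.
rewrite in_itv/= le_max ?leq_maxl// andbT.
by rewrite -[leRHS]invrK lef_pV2 ?posrE ?invr_gt0// le_max// leq_maxr.
Qed.

(** Monotone convergence along an exhaustion by compact intervals, on which the fundamental theorem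
    of calculus applies. *)
Lemma cvgn_integral_itv0y (R : realType) (f : R -> R) :
  {in `]0, +oo[, continuous f} -> (forall t, 0 < t -> 0 <= f t) ->
  (\int[lebesgue_measure]_(t in `[n.+1%:R^-1%R, n.+1%:R%R]) (f t)%:E)%E
    @[n --> \oo] --> (\int[lebesgue_measure]_(t in `]0%R, +oo[) (f t)%:E)%E.
Proof.
move=> cf f0; rewrite -bigcup_itv_invn_n.
have n0 n t : n.+1%:R^-1 <= t -> (0 : R) < t.
  by apply: lt_le_trans; rewrite invr_gt0.
apply: ge0_nondecreasing_set_cvg_integral => //.
- apply/nondecreasing_seqP => n; rewrite subsetEset => t/=.
  rewrite !in_itv/= => /andP[nt tn]; apply/andP; split.
    by apply: le_trans nt; rewrite lef_pV2 ?posrE// ler_nat.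
  by apply: (le_trans tn); rewrite ler_nat.
- move=> n; apply/measurable_EFinP; apply: subspace_continuous_measurable_fun => //.
  apply: in_itv_within_continuous => t; rewrite in_itv/= => /andP[nt _].
  by apply: cf; rewrite in_itv/= andbT (n0 n).
- move=> n t/=; rewrite in_itv/= => /andP[nt _].
  by rewrite lee_fin f0// (n0 n).
Qed.

Lemma continuous_powR_expRN (R : realType) (x : R) :
  {in `]0, +oo[, continuous (fun t : R => t `^ x * expR (- t))}.
Proof.
move=> t; rewrite in_itv/= andbT => t0.
apply: (@continuousM _ _ (fun t : R => t `^ x) (fun t => expR (- t))).
  exact: continuous_powR.
by apply: continuous_comp; [exact: continuousN|exact: continuous_expR].
Qed.

(** Integration by parts on [[1/(n+1), n+1]], followed by a limit in the extended reals, where it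
    makes sense whether or not Euler's integral is finite. *)
Lemma GammaD1 (R : realType) (x : R) : 0 < x -> Gamma (x + 1) = x * Gamma x.
Proof.
move=> x0; rewrite /Gamma addrK.
pose g y t : R := t `^ y * expR (- t).
pose I y n := (\int[lebesgue_measure]_(t in `[n.+1%:R^-1, n.+1%:R]) g y t)%R.
pose J y := (\int[lebesgue_measure]_(t in `]0%R, +oo[) (g y t)%:E)%E.
have J0 y : (0 <= J y)%E.
  by apply: integral_ge0 => t _; rewrite lee_fin mulr_ge0 ?powR_ge0 ?expR_ge0.
have cg y n : {in `[n.+1%:R^-1, n.+1%:R], continuous (g y)}.
  move=> t; rewrite in_itv/= => /andP[nt _]; apply: continuous_powR_expRN.
  by rewrite in_itv/= andbT (lt_le_trans _ nt)// invr_gt0.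
have IJ y : (I y n)%:E @[n --> \oo] --> J y.
  have := @cvgn_integral_itv0y _ (g y) (@continuous_powR_expRN _ y).
  rewrite (_ : (fun n : nat => _) = (fun n => (I y n)%:E)); last first.
    apply/funext => n; rewrite /I /Rintegral fineK//.
    exact: integrable_fin_num (continuous_itv_integrable (cg _ _)).
  by apply => t _; rewrite mulr_ge0 ?powR_ge0 ?expR_ge0.
have IE n : I x n = x * I (x - 1) n - (g x n.+1%:R - g x n.+1%:R^-1).
  have <- : \int[lebesgue_measure]_(t in `[n.+1%:R^-1, n.+1%:R])
      (x * g (x - 1) t - g x t) = g x n.+1%:R - g x n.+1%:R^-1.
    apply: is_derive_FTC2.
    - by rewrite (@le_trans _ _ 1)// ?invf_le1// ler1n.
    - move=> t; rewrite in_itv/= => /andP[nt _].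
      have t0 : 0 < t by rewrite (lt_le_trans _ nt)// invr_gt0.
      have := is_derive1_powR x t0 => dp.
      apply: is_derive_eq.
      rewrite /GRing.scale/= /g; ring.
    - move=> t tn; apply: cvgB; last exact: cg tn.
      by apply: cvgM; [exact: cvg_cst|exact: cg tn].
  rewrite RintegralB//; last 2 first.
  - apply: continuous_itv_integrable => t tn.
    by apply: cvgM; [exact: cvg_cst|exact: cg tn].
  - exact: continuous_itv_integrable.
  rewrite RintegralZl//; last exact: continuous_itv_integrable.
  by rewrite opprB addrCA subrr addr0.
have B0 : g x n.+1%:R - g x n.+1%:R^-1 @[n --> \oo] --> 0.
  rewrite -[X in _ --> X](subr0 0); apply: cvgB.
    exact: cvgn_powR_expRN (ltW x0).
  apply: (@squeeze_cvgr _ _ _ _ (fun=> 0) (fun n => n.+1%:R^-1 `^ x)).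
  - near=> n; rewrite mulr_ge0 ?powR_ge0 ?expR_ge0//=.
    by rewrite ler_piMr ?powR_ge0// -expR0 ler_expR oppr_le0 invr_ge0.
  - exact: cvg_cst.
  - exact: cvgn_powR_harmonic.
have JE : J x = (x%:E * J (x - 1)%R)%E.
  have {}IJx : (I x n)%:E @[n --> \oo] --> (x%:E * J (x - 1)%R - 0)%E.
    rewrite (_ : (fun n => _) =
        (fun n => x%:E * (I (x - 1) n)%:E - (g x n.+1%:R - g x n.+1%:R^-1)%:E)%E).
      apply: cvgeB; [by rewrite fin_num_adde_defl| |by apply: cvg_EFin => //; near=> n].
      exact: cvgeZl.
    by apply/funext => n; rewrite IE EFinB EFinM.
  by rewrite -[RHS]sube0; apply: cvg_unique (IJ x) IJx; exact: ereal_hausdorff.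
rewrite /Rintegral; transitivity (fine (J x)) => //.
(* If the integral is infinite, [fine] gives 0 on both sides and the identity still holds. *)
rewrite JE; have := J0 (x - 1); rewrite -/(J (x - 1)).
by case: (J (x - 1)) => [r| |]//= _; rewrite gt0_muley ?lte_fin//= mulr0.
Unshelve. all: by end_near. Qed.

(** * The Bessel function as a power series *)

Section entire_series.
Variables (R : realType) (c : R^nat) (C : R).
Hypothesis cC : forall k, `|c k| <= C / k`!%:R.

(** The factor [k + 1] produced by differentiation cancels against the factorial, so all derivatives
    keep the majorant [C exp]. *)
Lemma le_iter_pseries_diffs n k :
  `|iter n (@pseries_diffs R) c k| <= C / k`!%:R.
Proof.
elim: n k => //= n IH k; rewrite /pseries_diffs normrM normr_nat.
rewrite -ler_pdivlMl ?ltr0n// (le_trans (IH _))// factS natrM invfM.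
by rewrite mulrCA.
Qed.

Lemma is_cvg_iter_pseries_diffs n x :
  cvgn (pseries (iter n (@pseries_diffs R) c) x).
Proof.
apply: normed_cvg.
apply: (@series_le_cvg _ _ (fun k => C * exp_coeff `|x| k)) => [k|k|k|] //=.
- rewrite mulr_ge0 ?exp_coeff_ge0//.
  by have := le_trans (normr_ge0 _) (cC 0); rewrite fact0 divr1.
- rewrite normrM normrX exp_coeffE/= mulrA ler_wpM2r ?exprn_ge0//.
  exact: le_iter_pseries_diffs.
- exact/is_cvg_seriesZ/is_cvg_series_exp_coeff.
Qed.

Lemma is_derive_iter_pseries_diffs n (x : R) :
  is_derive x 1 (fun x => limn (pseries (iter n (@pseries_diffs R) c) x))
    (limn (pseries (iter n.+1 (@pseries_diffs R) c) x)).
Proof.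
apply: (@pseries_snd_diffs _ _ (`|x| + 1)).
- exact: is_cvg_iter_pseries_diffs.
- exact: (@is_cvg_iter_pseries_diffs n.+1).
- exact: (@is_cvg_iter_pseries_diffs n.+2).
by rewrite [ltRHS]ger0_norm ?addr_ge0// ltrDl.
Qed.

End entire_series.

Section clifford.
Variables (R : realType) (alpha : R).
Hypothesis halpha : - 2^-1 <= alpha.

(** The Pochhammer symbol [(alpha + 1)_k]. *)
Definition rising (k : nat) : R := \prod_(i < k) (alpha + i.+1%:R).

Definition clifford_coeff (k : nat) : R := (-1) ^+ k / (k`!%:R * rising k).

(** The [n]-th derivative of the Bessel-Clifford function. At [w = (z/2)^2] the case [n = 0] is the
    normalized Bessel function written as an entire series, free of real powers. *)
Definition clifford (n : nat) (w : R) : R :=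
  limn (pseries (iter n (@pseries_diffs R) clifford_coeff) w).

Lemma risingS k : rising k.+1 = rising k * (alpha + k.+1%:R).
Proof. by rewrite /rising big_ord_recr. Qed.

(** The factor [alpha + 1] is at least 1/2 and the later ones are at least 1; hence the constant 2
    in the majorant of the coefficients. *)
Lemma rising_ge k : 2^-1 <= rising k.
Proof.
case: k => [|k]; first by rewrite /rising big_ord0 invf_le1// ler1n.
elim: k => [|k IH]; first by rewrite risingS /rising big_ord0 mul1r; move: halpha; lra.
rewrite risingS (le_trans IH)// ler_peMr//; first by lra.
by rewrite -!natr1; have := ler0n R k; move: halpha; lra.
Qed.

Lemma norm_clifford_coeff_le k : `|clifford_coeff k| <= 2 / k`!%:R.
Proof.
have r0 := rising_ge k.
rewrite normrM normrX normrN1 expr1n mul1r normfV normrM invfM mulrC.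
rewrite normr_nat ler_wpM2r ?invr_ge0// -[leRHS]invrK lef_pV2 ?posrE//.
  by rewrite (le_trans r0)// ler_norm.
by rewrite normr_gt0; lra.
Qed.

Lemma is_cvg_clifford n w :
  cvgn (pseries (iter n (@pseries_diffs R) clifford_coeff) w).
Proof. exact: (@is_cvg_iter_pseries_diffs _ _ 2 norm_clifford_coeff_le). Qed.

Lemma is_derive_clifford n (w : R) :
  is_derive w 1 (clifford n) (clifford n.+1 w).
Proof. exact: (@is_derive_iter_pseries_diffs _ _ 2 norm_clifford_coeff_le). Qed.

(** Coefficient form of [w y'' + (alpha + 1) y' + y = 0]. *)
Lemma clifford_coeffS k :
  (k.+1%:R + alpha) * pseries_diffs clifford_coeff k = - clifford_coeff k.
Proof.
have r0 := rising_ge k; rewrite /pseries_diffs /clifford_coeff risingS.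
have r1 : alpha + k.+1%:R != 0 by rewrite -natr1; have := ler0n R k; move: halpha; lra.
have r2 : rising k != 0 by lra.
have f0 : k`!%:R != 0 :> R by rewrite pnatr_eq0 -lt0n fact_gt0.
have k0 : k.+1%:R != 0 :> R by rewrite pnatr_eq0.
rewrite factS natrM exprS; field.
by rewrite r2 f0 nat1r r1 k0.
Qed.

Lemma clifford_ode w :
  w * clifford 2 w + (alpha + 1) * clifford 1 w + clifford 0 w = 0.
Proof.
have c0 := @is_cvg_clifford 0 w.
have c1 := @is_cvg_clifford 1 w.
have := @is_cvg_clifford 2 w.
(* The second derivative is re-indexed so that, multiplied by [w], it carries the same power [w^i]
   as the other two series; the combination then vanishes term by term, already in the partial
   sums. *)
move=> /pseries_diffs_equiv/= c2.
have -> : w * clifford 2 w + (alpha + 1) * clifford 1 w + clifford 0 w =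
  limn (fun n =>
    w * series (fun i => i%:R * pseries_diffs clifford_coeff i * w ^+ i.-1) n
    + (alpha + 1) * pseries (pseries_diffs clifford_coeff) w n
    + pseries clifford_coeff w n).
  apply/esym/cvg_lim; first exact: Rhausdorff.
  exact: cvgD (cvgD (cvgM (cvg_cst w) c2) (cvgM (cvg_cst (alpha + 1)) c1)) c0.
rewrite [X in limn X](_ : _ = fun=> 0) ?lim_cst//; apply/funext => n.
rewrite /pseries/series/= !mulr_sumr -!big_split big1//= => i _.
have -> : w * (i%:R * pseries_diffs clifford_coeff i * w ^+ i.-1) =
    i%:R * pseries_diffs clifford_coeff i * w ^+ i.
  by case: i => [|i]; rewrite ?mul0r ?mulr0// exprS; ring.
have := clifford_coeffS i; rewrite -natr1 => /eqP; rewrite -subr_eq0 opprK.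
by move/eqP => E; rewrite -[RHS](mul0r (w ^+ i)) -E; ring.
Qed.

Lemma Gamma_rising k : Gamma (k%:R + alpha + 1) = rising k * Gamma (alpha + 1).
Proof.
elim: k => [|k IH]; first by rewrite /rising big_ord0 add0r mul1r.
have -> : k.+1%:R + alpha + 1 = k%:R + alpha + 1 + 1 by rewrite -natr1; ring.
rewrite (@GammaD1 _ (k%:R + alpha + 1)); last first.
  by have := ler0n R k; move: halpha; lra.
by rewrite IH risingS -natr1; ring.
Qed.

(* The quotient is 1 unless the integral defining Gamma takes the junk value 0,
   in which case besselj vanishes too; below it only matters that it is in
   [0, 1]. *)
Lemma besselj_clifford z : 0 < z ->
  besselj alpha z =
  Gamma (alpha + 1) / Gamma (alpha + 1) * clifford 0 ((z / 2) ^+ 2).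
Proof.
move=> z0; rewrite /besselj gt_eqF// /besselJ.
have z20 : 0 < z / 2 by rewrite divr_gt0.
pose K := (z / 2) `^ alpha / Gamma (alpha + 1).
have c0 := @is_cvg_clifford 0 ((z / 2) ^+ 2).
have -> : series (fun k : nat => (-1) ^+ k / (k`!%:R * Gamma (k%:R + alpha + 1)) *
    (z / 2) `^ (2 * k%:R + alpha)) =
    (fun n => K * pseries clifford_coeff ((z / 2) ^+ 2) n).
  apply/funext => n; rewrite /pseries/series/= mulr_sumr; apply: eq_bigr => k _.
  rewrite powRD; last by rewrite (gt_eqF z20) implybT.
  rewrite powRrM powR_mulrn ?powR_ge0//.
  rewrite (powR_mulrn 2) ?ltW// Gamma_rising /clifford_coeff /K !invfM; ring.
have -> : limn (fun n => K * pseries clifford_coeff ((z / 2) ^+ 2) n) =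
    K * clifford 0 ((z / 2) ^+ 2).
  by apply: cvg_lim; [exact: Rhausdorff|exact: cvgM (cvg_cst K) c0].
rewrite /K /clifford powRN; set G := Gamma _; move: (G^-1) => H; field.
by rewrite gt_eqF ?powR_gt0.
Qed.

Lemma clifford00 : clifford 0 0 = 1.
Proof.
apply/cvg_lim; first exact: Rhausdorff.
rewrite -cvg_shiftS; apply: cvg_near_cst; near=> n.
rewrite /pseries/series/= big_nat_recl//= big1 => [|i _].
  by rewrite expr0 mulr1 addr0 /clifford_coeff /rising big_ord0 fact0 mulr1 divr1.
by rewrite expr0n mulr0.
Unshelve. all: by end_near. Qed.

(** The chain rule along [w = (z/2)^2] turns the Clifford equation into Bessel's. The witness [j] is
    differentiable on the whole line, so 0 can serve as starting point for the energy. At 0 only a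
    bound is stated, since the factor [theta] is known to be 0 or 1 but not which. *)
Lemma besselj_ode : exists j j' : R -> R,
  [/\ forall z, 0 < z -> besselj alpha z = j z,
      forall z : R, is_derive z 1 j (j' z),
      forall z : R, 0 < z -> is_derive z 1 j' (- j z - (2 * alpha + 1) / z * j' z),
      continuous j' &
      `|j 0| <= 1 /\ j' 0 = 0].
Proof.
pose theta := Gamma (alpha + 1) / Gamma (alpha + 1).
pose sq (z : R) := (z / 2) ^+ 2.
pose j z := theta * clifford 0 (sq z).
pose j' z := theta * (z / 2 * clifford 1 (sq z)).
have dsq (z : R) : is_derive z 1 sq (z / 2).
  by rewrite /sq; apply: is_derive_eq; rewrite /GRing.scale/=; field.
have dL n (z : R) :
    is_derive z 1 (clifford n \o sq) (z / 2 * clifford n.+1 (sq z)).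
  rewrite mulrC; apply: is_derive1_comp; exact: is_derive_clifford.
have dj' (z : R) : is_derive z 1 j'
    (theta * (2^-1 * clifford 1 (sq z) + sq z * clifford 2 (sq z))).
  have := dL 1 z => ?; rewrite /j'.
  rewrite (_ : (fun z => _) = (fun z => theta * (z / 2 * (clifford 1 \o sq) z)))//.
  by apply: is_derive_eq; rewrite /GRing.scale/= /sq; field.
exists j, j'; split.
- by move=> z; exact: besselj_clifford.
- move=> z; have := dL 0 z => ?.
  rewrite /j (_ : (fun z => _) = (fun z => theta * (clifford 0 \o sq) z))//.
  by apply: is_derive_eq; rewrite /GRing.scale/= /j'; ring.
- move=> z z0; apply: is_derive_eq (dj' z) _; rewrite /j /j'.
  have /eqP := clifford_ode (sq z); rewrite addr_eq0 => /eqP.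
  move=> /(canRL (addrK _)) ->; field; exact: lt0r_neq0.
- by move=> z; exact: is_derive_continuous (dj' z).
- rewrite /j /j' /sq !mul0r mulr0 expr0n clifford00 mulr1; split=> //.
  rewrite /theta; have [->|G0] := eqVneq (Gamma (alpha + 1)) 0.
    by rewrite mul0r normr0.
  by rewrite divff// normr1.
Qed.

End clifford.

(** * Decay of the Bessel function *)

Lemma is_derive_nincry (R : realType) (F dF : R -> R) (a : R) :
  {in `[a, +oo[, continuous F} ->
  (forall x : R, a < x -> is_derive x 1 F (dF x)) ->
  (forall x, a < x -> dF x <= 0) ->
  forall x y, a <= x -> x <= y -> F y <= F x.
Proof.
move=> cF hF dF0; apply: ler0_derive1_nincry.
- by move=> x; rewrite in_itv/= andbT => /hF[].
- move=> x; rewrite in_itv/= andbT => ax.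
  by rewrite derive1E; case: (hF x ax) => _ ->; exact: dF0.
- exact: in_itv_within_continuous.
Qed.

Section bessel_decay.
Variables (R : realType) (p : R) (j j' : R -> R).
Hypothesis p0 : 0 <= p.
Hypothesis dj : forall z : R, is_derive z 1 j (j' z).
Hypothesis dj' : forall z : R, 0 < z -> is_derive z 1 j' (- j z - p / z * j' z).
Hypothesis cj' : continuous j'.
Hypothesis j0 : `|j 0| <= 1.
Hypothesis j'0 : j' 0 = 0.

Let cj : continuous j.
Proof. by move=> z; exact: is_derive_continuous (dj z). Qed.

(** Bessel's equation is an oscillator with friction [p / z], where [p] stands for [2 alpha + 1]:
    the energy has derivative [- 2 p / z j'^2], so it never exceeds its value at 0. *)
Lemma bessel_energy_le1 z : 0 <= z -> j z ^+ 2 + j' z ^+ 2 <= 1.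
Proof.
move=> z0; apply: (@le_trans _ _ (j 0 ^+ 2 + j' 0 ^+ 2)); last first.
  rewrite j'0 expr0n addr0 -[leRHS](expr1n _ 2).
  by rewrite -real_normK ?num_real// lerXn2r ?nnegrE.
pose E z := j z ^+ 2 + j' z ^+ 2.
apply: (@is_derive_nincry _ E (fun z => - (2 * p / z) * j' z ^+ 2) 0) => //.
- by move=> x _; apply: cvgD; rewrite expr2; apply: cvgM; (exact: cj || exact: cj').
- move=> x x0; have := dj x => ?; have := dj' x0 => ?.
  rewrite /E; apply: is_derive_eq; rewrite /GRing.scale/=; field.
  exact: lt0r_neq0.
- move=> x x0; rewrite mulNr oppr_le0 mulr_ge0 ?sqr_ge0//.
  by rewrite divr_ge0 ?mulr_ge0// ltW.
Qed.

Lemma bessel_le1 z : 0 <= z -> `|j z| <= 1.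
Proof.
move=> z0; rewrite -(ler_pXn2r (isT : (0 < 2)%N)) ?nnegrE// expr1n.
rewrite real_normK ?num_real//; have := bessel_energy_le1 z0.
by have := sqr_ge0 (j' z); lra.
Qed.

(* The cross term makes the derivative of z^p (j^2 + j'^2 + p / z * j j')
   equal to - p z^(p-2) j j', which is integrable against the energy itself;
   the exponential is the corresponding integrating factor. *)
Lemma bessel_energy_decay : exists B, forall z, 1 <= z ->
  z `^ p * (j z ^+ 2 + j' z ^+ 2) <= B.
Proof.
(* From [z0] on, [p / z <= 1], so the cross term takes away at most half of the energy and
   [Q + j j'] stays nonnegative, which makes [F] nonincreasing. Between 1 and [z0] the bound 1 on
   the energy is enough. *)
pose z0 := Num.max 1 p.
pose Q z := j z ^+ 2 + j' z ^+ 2 + p / z * (j z * j' z).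
pose F z := expR (p / z) * (z `^ p * Q z).
have z0_ge1 : 1 <= z0 by rewrite le_max lexx.
have z0p : p <= z0 by rewrite le_max lexx orbT.
have dF (x : R) : 0 < x -> is_derive x 1 F
    (- (p * expR (p / x) * x `^ p / x ^+ 2 * (Q x + j x * j' x))).
  move=> x0; have xN0 := lt0r_neq0 x0.
  have := dj x => ?; have := dj' x0 => ?; have := is_derive1_powR p x0 => ?.
  have ? : is_derive x 1 (fun z => z^-1) (- (x ^- 2)).
    have := @is_deriveV _ _ x _ _ xN0 (is_derive_id x (1 : R)).
    by rewrite /GRing.scale/= mulr1.
  have ? : is_derive x 1 (fun z => expR (p / z)) (expR (p / x) * (- p / x ^+ 2)).
    have ? : is_derive x 1 (fun z => p / z) (- p / x ^+ 2).
      apply: is_derive_eq; rewrite /GRing.scale/=; ring.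
    exact: (@is_derive1_comp _ expR (fun z => p / z)).
  rewrite /F /Q; apply: is_derive_eq; rewrite /GRing.scale/=.
  have -> : x `^ (p - 1) = x `^ p / x.
    by rewrite powRB ?xN0 ?implybT// powRr1// ltW.
  by field.
have Q_ge x : z0 <= x -> (j x ^+ 2 + j' x ^+ 2) / 2 <= Q x /\ 0 <= Q x + j x * j' x.
  move=> zx; have x0 : 0 < x by lra.
  have px0 : 0 <= p / x by rewrite divr_ge0// ltW.
  have px1 : p / x <= 1 by rewrite ler_pdivrMr// mul1r (le_trans z0p).
  rewrite /Q; move: (p / x) px0 px1 (j x) (j' x) => q q0 q1 a b.
  have h1 := mulr_ge0 q0 (sqr_ge0 (a + b)).
  have q1' : 0 <= 1 - q by rewrite subr_ge0.
  have h2 := mulr_ge0 q1' (addr_ge0 (sqr_ge0 a) (sqr_ge0 b)).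
  have h3 := sqr_ge0 (a + b).
  by split; lra.
have Fnincr x : z0 <= x -> F x <= F z0.
  apply: (@is_derive_nincry _ F (fun x =>
    (- (p * expR (p / x) * x `^ p / x ^+ 2 * (Q x + j x * j' x)))) z0) => //.
  - move=> t; rewrite in_itv/= andbT => zt.
    by apply: is_derive_continuous (dF t _); lra.
  - by move=> t zt; apply: dF; lra.
  - move=> t zt; rewrite oppr_le0 mulr_ge0//; last by have [] := Q_ge t (ltW zt).
    by rewrite divr_ge0 ?sqr_ge0// !mulr_ge0 ?expR_ge0 ?powR_ge0.
exists (Num.max (2 * F z0) (z0 `^ p)) => z z1.
rewrite le_max; apply/orP; have [zz|zz] := leP z0 z.
  left; apply: le_trans (_ : 2 * F z <= _); last by rewrite ler_pM2l// Fnincr.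
  have [Qz _] := Q_ge z zz.
  have : 1 <= expR (p / z).
    by rewrite -expR0 ler_expR divr_ge0//; lra.
  have /(ler_wpM2l (powR_ge0 z p)) := Qz.
  have : 0 <= z `^ p * ((j z ^+ 2 + j' z ^+ 2) / 2).
    by rewrite mulr_ge0 ?powR_ge0// divr_ge0// addr_ge0 ?sqr_ge0.
  rewrite /F; move: (expR _) => e; move: (Q z) => q; move: (z `^ p) => w; nra.
right; rewrite -[leRHS]mulr1; apply: ler_pM; rewrite ?powR_ge0 ?addr_ge0 ?sqr_ge0//.
  by rewrite ge0_ler_powR ?nnegrE// ?ltW//; lra.
by rewrite bessel_energy_le1//; lra.
Qed.

Lemma bessel_decay : exists2 C, 0 <= C & forall z, 1 <= z ->
  `|j z| <= C * z `^ (- (p / 2)) /\ `|j' z| <= C * z `^ (- (p / 2)).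
Proof.
have [B Bz] := bessel_energy_decay.
have B0 : 0 <= B.
  by apply: le_trans (Bz 1 _); rewrite // powR1 mul1r addr_ge0 ?sqr_ge0.
(* [1 + B] stands in for the square root of [B]: [u^2 <= B] implies [|u| <= 1 + B]. *)
exists (1 + B); first by rewrite addr_ge0.
move=> z z1; have z0 : 0 < z by lra.
have w0 : 0 < z `^ (p / 2) by rewrite powR_gt0.
have le_decay a : (z `^ (p / 2) * a) ^+ 2 <= B -> `|a| <= (1 + B) / z `^ (p / 2).
  move=> h; rewrite ler_pdivlMr// -(gtr0_norm w0) -normrM mulrC.
  by rewrite ler_norml; move: (_ * a) h => u; nra.
have wE : z `^ p = z `^ (p / 2) ^+ 2.
  by rewrite expr2 -powRD -?splitr// (gt_eqF z0) implybT.
have := Bz z z1; rewrite powRN wE; have := sqr_ge0 (j z); have := sqr_ge0 (j' z).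
by move=> ? ? ?; split; apply: le_decay; rewrite exprMn; nra.
Qed.

End bessel_decay.

(** * Riemann-Stieltjes integrals *)

Section Rintegral_itv.
Variable R : realType.
Implicit Types (f g : R -> R) (a b c M : R).
Local Notation mu := (@lebesgue_measure R).

Lemma integrable_itvS f a b c d : a <= c -> d <= b ->
  mu.-integrable `[a, b] (EFin \o f) -> mu.-integrable `[c, d] (EFin \o f).
Proof.
move=> ac db; apply: integrableS => //=.
by apply: subset_itv; rewrite bnd_simp.
Qed.

Lemma Rintegral_itv_split f a b c : a <= c -> c <= b ->
  mu.-integrable `[a, b] (EFin \o f) ->
  \int[mu]_(t in `[a, b]) f t =
  \int[mu]_(t in `[a, c]) f t + \int[mu]_(t in `[c, b]) f t.
Proof.
move=> ac cb fi; rewrite -(@Rintegral_itv_obnd_cbnd _ c); last first.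
  apply: integrableS fi => //=; apply: subset_itv; rewrite bnd_simp//.
by rewrite -(@Rintegral_itvB _ f (BLeft a) (BRight b) c)// ?bnd_simp// addrC subrK.
Qed.

Lemma bounded_itv_integrable f a b M : measurable_fun `[a, b] f ->
  (forall t, a <= t <= b -> `|f t| <= M) ->
  mu.-integrable `[a, b] (EFin \o f).
Proof.
move=> mf fM; apply: measurable_bounded_integrable => //=.
  by rewrite lebesgue_measure_itv/=; case: ifP => _; rewrite ?ltry//.
exists M; split; first exact: num_real.
by move=> x Mx t; rewrite /= in_itv => /fM/le_trans; apply; exact: ltW.
Qed.

Lemma le_norm_Rintegral_itv f a b M : a <= b ->
  mu.-integrable `[a, b] (EFin \o f) ->
  (forall t, a <= t <= b -> `|f t| <= M) ->
  `|\int[mu]_(t in `[a, b]) f t| <= M * (b - a).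
Proof.
move=> ab fi fM; apply: le_trans (le_normr_Rintegral _ fi) _ => //.
have -> : M * (b - a) = \int[mu]_(t in `[a, b]) M.
  rewrite Rintegral_cst//; congr (_ * _).
  have := lebesgue_measure_itv `[a, b]; rewrite /= lte_fin => /(congr1 fine) ->.
  by case: ltP => //= ba; rewrite (le_anti (introT andP (conj ab ba))) subrr.
apply: le_Rintegral => //=.
- exact: integrable_norm fi.
- by apply: continuous_itv_integrable => t _; exact: cvg_cst.
Qed.

Lemma le_norm_Rintegral f g a b :
  mu.-integrable `[a, b] (EFin \o f) -> mu.-integrable `[a, b] (EFin \o g) ->
  (forall t, a <= t <= b -> `|f t| <= g t) ->
  `|\int[mu]_(t in `[a, b]) f t| <= \int[mu]_(t in `[a, b]) g t.
Proof.
move=> fi gi fg; apply: le_trans (le_normr_Rintegral _ fi) _ => //.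
by apply: le_Rintegral => //=; exact: integrable_norm fi.
Qed.

End Rintegral_itv.

Section RS_by_parts.
Variables (R : realType) (g V H h : R -> R) (b K d : R).
Local Notation mu := (@lebesgue_measure R).

(** Only the left end is a parameter, because the induction on partitions drops the first cell and
    keeps [b]. The field [bp_incr] says [|dg| <= dV] through increments, so that jumps are
    allowed. *)
Record by_parts_data (a : R) : Prop := {
  bp_incr : forall s t, a <= s -> s <= t -> t <= b -> `|g t - g s| <= V t - V s;
  bp_meas : measurable_fun `[a, b] g;
  bp_deriv : {in `[a, b], forall t : R, is_derive t 1 H (h t)};
  bp_cont : {in `[a, b], continuous h};
  bp_bound : forall t, a <= t <= b -> `|h t| <= K }.

Lemma by_parts_dataS a c : a <= c -> by_parts_data a -> by_parts_data c.
Proof.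
move=> ac [gV mg dH ch hK]; split.
- by move=> s t cs; apply: gV; rewrite (le_trans ac).
- by apply: measurable_funS mg => //=; apply: subset_itv; rewrite bnd_simp.
- move=> t; rewrite in_itv/= => /andP[ct tb]; apply: dH.
  by rewrite in_itv/= (le_trans ac).
- move=> t; rewrite in_itv/= => /andP[ct tb]; apply: ch.
  by rewrite in_itv/= (le_trans ac).
- by move=> t /andP[ct tb]; apply: hK; rewrite (le_trans ac).
Qed.

Lemma by_parts_integrable a : by_parts_data a ->
  mu.-integrable `[a, b] (EFin \o (fun t => g t * h t)).
Proof.
move=> [gV mg dH ch hK].
apply: (@bounded_itv_integrable _ _ _ _ ((`|g a| + (V b - V a)) * K)).
  apply: measurable_funM => //.
  by have /integrableP[/measurable_EFinP] := continuous_itv_integrable ch.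
move=> t /andP[at_ tb]; rewrite normrM ler_pM ?hK ?at_//.
have := gV a t (lexx _) at_ tb; have := gV t b at_ tb (lexx _).
have := normr_ge0 (g b - g t); have := ler_dist_dist.
have := ler_normD (g t - g a) (g a); rewrite subrK; lra.
Qed.

(** On one cell with tag [x] the defect equals the integral of [(g - g a) h] over [[a, c]] minus
    [(g c - g a)] times the integral of [h] over [[x, c]]; each is at most [K d (V c - V a)]. The
    increment of [V] in the bound lets the errors telescope over a partition. *)
Lemma by_parts_step a c x : by_parts_data a -> a <= c -> c <= b ->
  a <= x -> x <= c -> c - a <= d ->
  `|\int[mu]_(t in `[a, c]) (g t * h t) - (g c * H c - g a * H a)
    + H x * (g c - g a)| <= 2 * K * d * (V c - V a).
Proof.
move=> D ac cb ax xc cad; have [gV mg dH ch hK] := D.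
have gh := integrable_itvS (lexx a) cb (by_parts_integrable D).
have chS y z : a <= y -> z <= c -> {in `[y, z], continuous h}.
  move=> ay zc t; rewrite in_itv/= => /andP[yt tz]; apply: ch.
  by rewrite in_itv/= (le_trans ay)// (le_trans tz)// (le_trans zc).
have dHS y z : a <= y -> z <= c -> {in `[y, z], forall t : R, is_derive t 1 H (h t)}.
  move=> ay zc t; rewrite in_itv/= => /andP[yt tz]; apply: dH.
  by rewrite in_itv/= (le_trans ay)// (le_trans tz)// (le_trans zc).
have hi y z (ay : a <= y) (zc : z <= c) := continuous_itv_integrable (chS y z ay zc).
have gahi : mu.-integrable `[a, c] (EFin \o (fun t => g a * h t)).
  apply: continuous_itv_integrable => t tac; apply: cvgM; first exact: cvg_cst.
  exact: chS tac.
have K0 : 0 <= K by apply: le_trans (hK a _); rewrite ?lexx ?(le_trans ac).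
have Vac : `|g c - g a| <= V c - V a by exact: gV.
have V0 : 0 <= V c - V a by exact: le_trans Vac.
have -> : \int[mu]_(t in `[a, c]) (g t * h t) - (g c * H c - g a * H a)
    + H x * (g c - g a) =
    \int[mu]_(t in `[a, c]) (g t * h t - g a * h t)
    - (\int[mu]_(t in `[x, c]) h t) * (g c - g a).
  rewrite RintegralB// RintegralZl//; last exact: hi.
  rewrite (is_derive_FTC2 ac (dHS _ _ _ _) (chS _ _ _ _))//.
  by rewrite (is_derive_FTC2 xc (dHS _ _ _ _) (chS _ _ _ _))//; ring.
have I1 : `|\int[mu]_(t in `[a, c]) (g t * h t - g a * h t)| <=
    (V c - V a) * K * (c - a).
  apply: le_norm_Rintegral_itv => //.
    rewrite (_ : EFin \o _ = (EFin \o (fun t => g t * h t)%R) \-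
      (EFin \o (fun t => g a * h t)%R))%E; last exact/funext.
    exact: integrableB.
  move=> t /andP[at_ tc]; rewrite -mulrBl normrM ler_pM ?hK ?at_ ?(le_trans tc)//.
  have := gV a t (lexx _) at_ (le_trans tc cb).
  have := gV t c at_ tc cb; have := normr_ge0 (g c - g t); lra.
have I2 : `|\int[mu]_(t in `[x, c]) h t| <= K * (c - x).
  apply: le_norm_Rintegral_itv => //; first exact: hi.
  by move=> t /andP[xt tc]; rewrite hK// (le_trans ax)// (le_trans tc).
rewrite (le_trans (ler_normB _ _))//.
rewrite [leRHS](_ : _ = (V c - V a) * K * d + K * d * (V c - V a)); last by ring.
rewrite lerD//.
  by rewrite (le_trans I1)// ler_wpM2l// mulr_ge0.
rewrite normrM ler_pM// (le_trans I2)// ler_wpM2l//; lra.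
Qed.

(* Applied with g = V, to get the existence of the Stieltjes integral, and with
   g the real or imaginary part of f. *)
Lemma RS_sum_by_parts a s xi : a <= b -> by_parts_data a -> itv_partition a b s ->
  (let x := nth b (a :: s) in
   forall n, (n < size s)%N -> x n.+1 - x n < d /\ x n <= nth b xi n <= x n.+1) ->
  `|\int[mu]_(t in `[a, b]) (g t * h t) - (g b * H b - g a * H a)
    + RS_sum a b H g s xi| <= 2 * K * d * (V b - V a).
Proof.
elim: s a xi => [|c s IH] a xi ab D.
  move=> /itv_partition_nil -> _.
  by rewrite set_itv1 Rintegral_set1 /RS_sum big_nil !subrr addr0 normr0 mulr0.
move=> [/=/andP[ac pcs] lcs] mesh.
have cb : c <= b by exact: itv_partition_le (conj pcs lcs).
have Dc := by_parts_dataS (ltW ac) D.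
have := IH c (behead xi) cb Dc (conj pcs lcs).
have mc : let x := nth b (c :: s) in forall n, (n < size s)%N ->
    x n.+1 - x n < d /\ x n <= nth b (behead xi) n <= x n.+1.
  by move=> x n ns; rewrite nth_behead; exact: (mesh n.+1).
move=> /(_ mc) {}IH.
have /=[cad /andP[ax xc]] := mesh 0 isT.
have := by_parts_step D (ltW ac) cb ax xc (ltW cad).
rewrite (Rintegral_itv_split (ltW ac) cb (by_parts_integrable D)).
have -> : RS_sum a b H g (c :: s) xi =
    H (nth b xi 0) * (g c - g a) + RS_sum c b H g s (behead xi).
  rewrite /RS_sum/= big_nat_recl//; congr (_ + _); apply: eq_bigr => i _.
  by rewrite nth_behead.
move: IH; rewrite !ler_norml => /andP[? ?] /andP[? ?]; apply/andP; split; lra.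
Qed.

End RS_by_parts.

Section RS_integral_theory.
Variable R : realType.
Implicit Types (a b d : R) (g V w : R -> R) (s : seq R).

Lemma fine_partition_exists a b d : 0 < d -> a <= b ->
  exists2 s, itv_partition a b s & path (fun x y => y - x < d) a s.
Proof.
move=> d0 ab; have [n] : exists n : nat, b - a < n%:R * (d / 2).
  exists (Num.truncn ((b - a) / (d / 2))).+1.
  by rewrite -ltr_pdivrMr ?divr_gt0// truncnS_gt.
elim: n a ab => [|n IH] a ab; first by rewrite mul0r; lra.
rewrite -natr1 => h; move: ab; rewrite le_eqVlt => /predU1P[<-|ab].
  by exists [::] => //; split.
have [bd|bd] := ltP (b - a) d.
  by exists [:: b]; [split=> //=; rewrite ?ab|rewrite /= bd].
have [||s [ps ls] ms] := IH (a + d / 2); [lra|lra|].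
exists (a + d / 2 :: s).
  by split=> //=; rewrite ps andbT; lra.
by rewrite /= ms andbT; lra.
Qed.

(** Using [s] as its own list of tags puts each tag at the right end of its cell, and Riemann sums
    then obey a plain recursion on [s]. *)
Lemma right_tagsP a b d s : itv_partition a b s ->
  path (fun x y => y - x < d) a s ->
  let x := nth b (a :: s) in
  forall n, (n < size s)%N -> x n.+1 - x n < d /\ x n <= nth b s n <= x n.+1.
Proof.
move=> [/(pathP b) ps _] /(pathP b) ms x n ns; split; first exact: ms.
by rewrite lexx andbT; exact/ltW/ps.
Qed.

Lemma RS_sum_cons a b g V c s y xi :
  RS_sum a b g V (c :: s) (y :: xi) = g y * (V c - V a) + RS_sum c b g V s xi.
Proof. by rewrite /RS_sum/= big_nat_recl. Qed.

Lemma RS_sum_right_cat a b c g V s t : last a s = b ->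
  RS_sum a c g V (s ++ t) (s ++ t) = RS_sum a b g V s s + RS_sum b c g V t t.
Proof.
elim: s a => [|x s IH] a /=; first by move=> ->; rewrite /RS_sum big_nil add0r.
by move=> /IH {}IH; rewrite !RS_sum_cons IH addrA.
Qed.

Lemma RS_sum_right_ge0 a b g V s : itv_partition a b s ->
  (forall x, a <= x <= b -> 0 <= g x) ->
  (forall x y, a <= x -> x <= y -> y <= b -> V x <= V y) ->
  0 <= RS_sum a b g V s s.
Proof.
elim: s a => [|x s IH] a; first by rewrite /RS_sum big_nil.
move=> [/=/andP[ax ps] ls] g0 ndV.
have xb : x <= b by exact: itv_partition_le (conj ps ls).
rewrite RS_sum_cons addr_ge0//.
  apply: mulr_ge0; first by rewrite g0// xb ltW.
  by rewrite subr_ge0 ndV// ltW.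
apply: IH => //.
  by move=> y /andP[xy yb]; rewrite g0// yb (le_trans (ltW ax)).
by move=> y z xy; apply: ndV; rewrite (le_trans (ltW ax)).
Qed.

Lemma le_norm_RS_sum_right a b g V w H s : itv_partition a b s ->
  (forall x, a <= x <= b -> `|H x| <= w x) ->
  (forall x y, a <= x -> x <= y -> y <= b -> `|g y - g x| <= V y - V x) ->
  `|RS_sum a b H g s s| <= RS_sum a b w V s s.
Proof.
elim: s a => [|x s IH] a; first by rewrite /RS_sum !big_nil normr0.
move=> [/=/andP[ax ps] ls] Hw gV.
have xb : x <= b by exact: itv_partition_le (conj ps ls).
rewrite !RS_sum_cons (le_trans (ler_normD _ _))// lerD//.
  rewrite normrM; apply: ler_pM => //; first by rewrite Hw// xb ltW.
  by rewrite gV// ltW.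
apply: IH => //.
  by move=> y /andP[xy yb]; rewrite Hw// yb (le_trans (ltW ax)).
by move=> y z xy; apply: gV; rewrite (le_trans (ltW ax)).
Qed.

(** [RS_sum_by_parts] with [g = V]: a smooth integrand is Stieltjes integrable against a monotone
    function, jumps included, and the value is explicit. *)
Lemma is_RS_integral_by_parts a b V H h K : a <= b ->
  by_parts_data V V H h b K a ->
  is_RS_integral a b H V
    (V b * H b - V a * H a - \int[lebesgue_measure]_(t in `[a, b]) (V t * h t)).
Proof.
move=> ab D e e0.
have K0 : 0 <= K by apply: le_trans (bp_bound D (t := a) _); rewrite ?lexx.
have V0 : 0 <= V b - V a.
  by apply: le_trans (bp_incr D (lexx a) ab (lexx b)).
(* The [+ 1] keeps [m] positive and makes the final inequality strict. *)
pose m := 2 * K * (V b - V a) + 1.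
have m0 : 0 < m by rewrite ltr_pwDr// !mulr_ge0.
exists (e / m); first by rewrite divr_gt0.
move=> s xi ps x mesh.
have := RS_sum_by_parts ab D ps mesh.
rewrite -[leRHS]mulrA [leRHS](_ : _ = e * ((2 * K * (V b - V a)) / m)); last by ring.
have : e * ((2 * K * (V b - V a)) / m) < e.
  by rewrite gtr_pMr// ltr_pdivrMr// mul1r ltrDl.
move=> /[swap] /le_lt_trans /[apply].
by congr (_ < _); congr `|_|; ring.
Qed.

(** A fine partition of [[a, b]] is continued to one of [[a, c]]; the two Riemann sums differ by the
    nonnegative sum over [[b, c]]. *)
Lemma le_RS_integral_right a b c w V : a <= b -> b <= c ->
  (forall x, a <= x <= c -> 0 <= w x) ->
  (forall x y, a <= x -> x <= y -> y <= c -> V x <= V y) ->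
  is_RS_integral a b w V (RS_integral a b w V) ->
  is_RS_integral a c w V (RS_integral a c w V) ->
  RS_integral a b w V <= RS_integral a c w V.
Proof.
move=> ab bc w0 ndV Ib Ic; apply/ler_addgt0Pr => e e0.
have e20 : 0 < e / 2 by rewrite divr_gt0.
have [d1 d10 H1] := Ib _ e20; have [d2 d20 H2] := Ic _ e20.
pose d := Num.min d1 d2.
have d0 : 0 < d by rewrite lt_min d10.
have [s ps ms] := fine_partition_exists d0 ab.
have [t pt mt] := fine_partition_exists d0 bc.
have weaken d' x u : d <= d' -> path (fun x y => y - x < d) x u ->
    path (fun x y => y - x < d') x u.
  by move=> dd'; apply: sub_path => y z /lt_le_trans; apply.
have := H1 s s ps (right_tagsP ps (weaken _ _ _ _ ms)).
have := H2 (s ++ t) (s ++ t) (itv_partition_cat ps pt).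
have [_ /eqP ls] := ps.
have mst : path (fun x y => y - x < d) a (s ++ t) by rewrite cat_path ms ls.
move=> /(_ (right_tagsP (itv_partition_cat ps pt) (weaken _ _ _ _ mst))).
rewrite !ge_min !lexx orbT => /(_ isT) h2 /(_ isT).
have : 0 <= RS_sum b c w V t t.
  apply: RS_sum_right_ge0 => //.
    by move=> x /andP[bx xc]; rewrite w0// xc (le_trans ab).
  by move=> x y bx; apply: ndV; rewrite (le_trans ab).
move: h2; rewrite (RS_sum_right_cat _ _ _ _ ls) !ltr_norml.
by move=> /andP[? ?] ? /andP[? ?]; lra.
Qed.

Lemma is_RS_integralZl a b w V I A : is_RS_integral a b w V I ->
  is_RS_integral a b (fun t => A * w t) V (A * I).
Proof.
move=> RSI e e0; have A0 : 0 < `|A| + 1 by rewrite ltr_wpDl.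
have [d d0 H] := RSI _ (divr_gt0 e0 A0); exists d => // s xi ps x mesh.
have -> : RS_sum a b (fun t => A * w t) V s xi = A * RS_sum a b w V s xi.
  by rewrite /RS_sum mulr_sumr; apply: eq_bigr => i _; rewrite mulrA.
rewrite -mulrBr normrM; apply: le_lt_trans (_ : (`|A| + 1) * _ < _).
  by apply: ler_wpM2r; [exact: normr_ge0|rewrite lerDl].
by rewrite mulrC -ltr_pdivlMr// H.
Qed.

(** On a single fine partition the integral is close to the boundary terms minus a Riemann sum of
    [H] against [g]. That sum is dominated, cell by cell, by the sum of [w] against [V], which is
    close to [I]. The constant [K] influences the mesh only, not the bound. *)
Lemma norm_Rintegral_by_parts a b g V H h K w I : a <= b ->
  by_parts_data g V H h b K a ->
  (forall x, a <= x <= b -> `|H x| <= w x) ->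
  is_RS_integral a b w V I ->
  `|\int[lebesgue_measure]_(t in `[a, b]) (g t * h t)| <=
  `|g b| * w b + `|g a| * w a + I.
Proof.
move=> ab D Hw Iw; apply/ler_addgt0Pr => e e0.
have e20 : 0 < e / 2 by rewrite divr_gt0.
have [d1 d10 H1] := Iw _ e20.
have K0 : 0 <= K by apply: le_trans (bp_bound D (t := a) _); rewrite ?lexx.
have V0 : 0 <= V b - V a by apply: le_trans (bp_incr D (lexx a) ab (lexx b)).
pose m := 2 * K * (V b - V a) + 1.
have m0 : 0 < m by rewrite ltr_pwDr// !mulr_ge0.
pose d := Num.min d1 (e / 2 / m).
have d0 : 0 < d by rewrite lt_min d10 divr_gt0.
have [s ps ms] := fine_partition_exists d0 ab.
have ms1 : path (fun x y => y - x < d1) a s.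
  by apply: sub_path ms => y z /lt_le_trans; apply; rewrite ge_min lexx.
have hI := H1 s s ps (right_tagsP ps ms1).
have hP := RS_sum_by_parts ab D ps (right_tagsP ps ms).
have hR := le_norm_RS_sum_right ps Hw (bp_incr D).
have hd : 2 * K * d * (V b - V a) <= e / 2.
  have : d * m <= e / 2 by rewrite -ler_pdivlMr// ge_min lexx orbT.
  by apply: le_trans; rewrite /m; lra.
have hb : `|g b * H b| <= `|g b| * w b.
  by rewrite normrM ler_wpM2l// Hw// ab lexx.
have ha : `|g a * H a| <= `|g a| * w a.
  by rewrite normrM ler_wpM2l// Hw// ab lexx.
move: hI hP hR hb ha; rewrite ltr_norml !ler_norml.
move=> /andP[? ?] /andP[? ?] /andP[? ?] /andP[? ?] /andP[? ?].
by apply/andP; split; lra.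
Qed.

End RS_integral_theory.

(** * Total variation *)

Lemma Re_normc_le (R : realType) (z : R[i]) : `|complex.Re z| <= normc z.
Proof.
by case: z => x y /=; rewrite -sqrtr_sqr ler_wsqrtr// lerDl sqr_ge0.
Qed.

Lemma Im_normc_le (R : realType) (z : R[i]) : `|complex.Im z| <= normc z.
Proof.
by case: z => x y /=; rewrite -sqrtr_sqr ler_wsqrtr// lerDr sqr_ge0.
Qed.

Lemma normc_ge0 (R : realType) (z : R[i]) : 0 <= normc z.
Proof. by case: z => x y; rewrite sqrtr_ge0. Qed.

Section complex_variation.
Variables (R : realType) (f : R -> R[i]).
Implicit Types a b c t : R.

Lemma cvariation_cons a b c s :
  cvariation a b f (c :: s) = normc (f c - f a) + cvariation c b f s.
Proof. by rewrite /cvariation/= big_nat_recl. Qed.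

Lemma cvariation_rcons a b c s : last a s = b ->
  cvariation a c f (rcons s c) = cvariation a b f s + normc (f c - f b).
Proof.
elim: s a => [|x s IH] a /=.
  by move=> ->; rewrite cvariation_cons addrC /cvariation/= !big_nil.
by move=> /IH {}IH; rewrite !cvariation_cons IH addrA.
Qed.

Lemma cvariation_ge0 a b s : 0 <= cvariation a b f s.
Proof. by apply: sumr_ge0 => i _; exact: normc_ge0. Qed.

Hypothesis fBV : clocally_BV_pos f.

Lemma ctotal_variation_fin_num a b : 0 < a -> a <= b ->
  ctotal_variation a b f \is a fin_num.
Proof.
move=> a0 ab; rewrite ge0_fin_numE; last first.
  have [s ps _] := fine_partition_exists ltr01 ab.
  apply: (@le_trans _ _ (cvariation a b f s)%:E).
    by rewrite lee_fin cvariation_ge0.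
  by apply: ereal_sup_ubound; exists (cvariation a b f s) => //; exists s.
(* [clocally_BV_pos] speaks of [a < b]; for [a = b] the only partition is empty. *)
move: ab; rewrite le_eqVlt => /predU1P[<-|ab].
  apply: (@le_lt_trans _ _ 0%E) => //; apply: ge_ereal_sup => _ [_ [s ps <-] <-].
  by rewrite (itv_partitionxx ps) /cvariation/= big_nil.
have [M fM] := fBV a0 ab; apply: (@le_lt_trans _ _ M%:E); last exact: ltry.
by apply: ge_ereal_sup => _ [x fx <-]; rewrite lee_fin fM.
Qed.

(** Appending [c] to any partition of [[a, b]] adds [|f c - f b|] to its variation. *)
Lemma normc_le_ctotal_variation a b c : 0 < a -> a <= b -> b <= c ->
  normc (f c - f b) <=
  fine (ctotal_variation a c f) - fine (ctotal_variation a b f).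
Proof.
move=> a0 ab; rewrite le_eqVlt => /predU1P[<-|bc].
  by rewrite !subrr normc0.
have fb := ctotal_variation_fin_num a0 ab.
have fc := ctotal_variation_fin_num a0 (le_trans ab (ltW bc)).
rewrite lerBrDr -lerBrDl -lee_fin fineK// EFinB fineK//.
apply: ge_ereal_sup => _ [_ [s [ps ls] <-] <-].
rewrite leeBrDr// -EFinD -(@cvariation_rcons _ _ _ _ (eqP ls)).
apply: ereal_sup_ubound; exists (cvariation a c f (rcons s c)) => //.
exists (rcons s c) => //; split; last by rewrite last_rcons.
by rewrite rcons_path ps (eqP ls).
Qed.

End complex_variation.

(** A power is monotone in one direction or the other; the sum of both end values bounds it without
    regard to the sign of [p]. *)
Lemma powR_le_ends (R : realType) (a b t p : R) : 0 < a -> a <= t -> t <= b ->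
  t `^ p <= a `^ p + b `^ p.
Proof.
move=> a0 at_ tb; have t0 := lt_le_trans a0 at_; have b0 := lt_le_trans t0 tb.
have [p0|p0] := leP 0 p.
  apply: (@le_trans _ _ (b `^ p)); last by rewrite lerDr powR_ge0.
  by apply: ge0_ler_powR => //; rewrite nnegrE ltW.
apply: (@le_trans _ _ (a `^ p)); last by rewrite lerDl powR_ge0.
rewrite -[p]opprK !(powRN _ (- p)) lef_pV2 ?posrE ?powR_gt0//.
by apply: ge0_ler_powR => //; rewrite ?nnegrE ?oppr_ge0 ltW.
Qed.

Section variation_integral.
Variables (R : realType) (f : R -> R[i]) (beta : R).
Hypothesis fBV : clocally_BV_pos f.
Implicit Types a b c t : R.

Let w t := t `^ beta.

Lemma le_ctotal_variation a b c : 0 < a -> a <= b -> b <= c ->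
  fine (ctotal_variation a b f) <= fine (ctotal_variation a c f).
Proof.
move=> a0 ab bc; rewrite -subr_ge0.
exact: le_trans (normc_ge0 _) (normc_le_ctotal_variation fBV a0 ab bc).
Qed.

Lemma measurable_ctotal_variation a b : 0 < a -> a <= b ->
  measurable_fun `[a, b] (fun t => fine (ctotal_variation a t f)).
Proof.
move=> a0 ab.
(* Clamping makes the variation nondecreasing on the whole line, hence measurable, and changes
   nothing on [[a, b]]. *)
pose clamp t := Num.max a (Num.min t b).
apply: (eq_measurable_fun (fun t => fine (ctotal_variation a (clamp t) f))).
  move=> t; rewrite inE/= in_itv/= => /andP[at_ tb].
  by rewrite /clamp (min_idPl tb) (max_idPr at_).
apply: nondecreasing_measurable => // x y xy.
apply: le_ctotal_variation => //; first by rewrite le_max lexx.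
by rewrite /clamp ge_max !le_max lexx/= le_min !ge_min xy lexx !orbT.
Qed.

(** [variation_integral] is defined by choice; this shows that the chosen value is a true
    integral. *)
Lemma is_RS_variation_integral a b : 0 < a -> a <= b ->
  is_RS_integral a b w (fun t => fine (ctotal_variation a t f))
    (variation_integral a b w f).
Proof.
move=> a0 ab; apply: getPex; pose h t := beta * t `^ (beta - 1).
have pos t : t \in `[a, b] -> 0 < t.
  by rewrite in_itv/= => /andP[/(lt_le_trans a0)].
eexists; apply: (@is_RS_integral_by_parts _ _ _ _ _ h
  (`|beta| * (a `^ (beta - 1) + b `^ (beta - 1)))) => //; split.
- move=> s t as_ st tb; rewrite ger0_norm// subr_ge0.
  exact: le_ctotal_variation.
- exact: measurable_ctotal_variation.
- by move=> t /pos; exact: is_derive1_powR.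
- move=> t /pos t0; apply: cvgM; first exact: cvg_cst.
  exact: continuous_powR.
- move=> t /andP[at_ tb]; rewrite normrM ler_wpM2l// ger0_norm ?powR_ge0//.
  exact: powR_le_ends.
Qed.

Lemma le_variation_integral_infty a b : 0 < a -> a <= b ->
  ((variation_integral a b w f)%:E <= variation_integral_infty a w f)%E.
Proof.
(* For [t < a] there is no partition of [[a, t]] and the chosen value is arbitrary; the maximum
   removes these [t], so that [VI] is nondecreasing and its limit is its supremum. *)
move=> a0 ab; pose VI t := variation_integral a (Num.max a t) w f.
have ndVI : nondecreasing_fun (EFin \o VI).
  move=> x y xy; rewrite lee_fin.
  have axy : Num.max a x <= Num.max a y by rewrite ge_max !le_max lexx xy orbT.
  have ax : a <= Num.max a x by rewrite le_max lexx.
  apply: le_RS_integral_right => //.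
  - by move=> *; exact: powR_ge0.
  - by move=> s t as_ st _; exact: le_ctotal_variation.
  - exact: is_RS_variation_integral.
  - by apply: is_RS_variation_integral => //; exact: le_trans axy.
have -> : variation_integral_infty a w f = ereal_sup (range (EFin \o VI)).
  apply: cvg_lim => //; apply: cvg_trans (nondecreasing_cvge ndVI).
  apply: near_eq_cvg; near=> t.
  have at_ : a <= t by near: t; apply: nbhs_pinfty_ge; exact: num_real.
  by rewrite /VI/= (max_idPr at_).
by apply: ereal_sup_ubound; exists b => //=; rewrite /VI (max_idPr ab).
Unshelve. all: by end_near. Qed.

End variation_integral.

(** * Estimates of the truncated transform *)

Section powR_gt0.
Variable R : realType.
Implicit Types x y a b e : R.

Lemma powRMD x a b : 0 < x -> x `^ a * x `^ b = x `^ (a + b).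
Proof. by move=> x0; rewrite powRD// (gt_eqF x0) implybT. Qed.

Lemma powRS x a : 0 < x -> x `^ a = x `^ (a - 1) * x.
Proof.
by move=> x0; rewrite -[X in _ * X]powRr1 ?ltW// powRMD// subrK.
Qed.

Lemma le0_powR_le1 x e : 1 <= x -> e <= 0 -> x `^ e <= 1.
Proof. by move=> x1 e0; rewrite -(powRr0 x); exact: ler_powR. Qed.

Lemma le0_ler_powR x y e : 0 < x -> x <= y -> e <= 0 -> y `^ e <= x `^ e.
Proof.
move=> x0 xy e0; rewrite -[e]opprK !(powRN _ (- e)).
rewrite lef_pV2 ?posrE ?powR_gt0 ?(lt_le_trans x0)//.
by apply: ge0_ler_powR; rewrite ?nnegrE ?oppr_ge0// ltW// (lt_le_trans x0).
Qed.

Lemma Rintegral_powR a b e : 0 < a -> a <= b -> e != 0 ->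
  \int[lebesgue_measure]_(t in `[a, b]) t `^ (e - 1) = (b `^ e - a `^ e) / e.
Proof.
move=> a0 ab e0; rewrite mulrBl.
apply: (@is_derive_FTC2 _ (fun t => t `^ e / e)) => // t.
  rewrite in_itv/= => /andP[/(lt_le_trans a0) t0 _].
  have ? := is_derive1_powR e t0.
  by apply: is_derive_eq; rewrite /GRing.scale/=; field.
rewrite in_itv/= => /andP[/(lt_le_trans a0) t0 _].
exact: continuous_powR.
Qed.

Lemma integrable_powR a b e : 0 < a ->
  lebesgue_measure.-integrable `[a, b] (EFin \o (fun t => t `^ e)).
Proof.
move=> a0; apply: continuous_itv_integrable => t.
rewrite in_itv/= => /andP[/(lt_le_trans a0) t0 _].
exact: continuous_powR.
Qed.

Lemma integrable_ZpowR A a b e : 0 < a ->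
  lebesgue_measure.-integrable `[a, b] (EFin \o (fun t => A * t `^ e)).
Proof.
move=> a0; apply: continuous_itv_integrable => t.
rewrite in_itv/= => /andP[/(lt_le_trans a0) t0 _].
by apply: cvgM; [exact: cvg_cst|exact: continuous_powR].
Qed.

End powR_gt0.

Section hankel_estimates.
Variables (R : realType) (q nu mu C : R) (j j' : R -> R).
Hypothesis sigma_gt0 : 0 < mu + nu.
Hypothesis sigma_le : mu + nu <= q + 1.
Hypothesis dj : forall z : R, is_derive z 1 j (j' z).
Hypothesis dj' : forall z : R, 0 < z ->
  is_derive z 1 j' (- j z - 2 * q / z * j' z).
Hypothesis cj' : continuous j'.
Hypothesis j_le1 : forall z, 0 <= z -> `|j z| <= 1.
Hypothesis C0 : 0 <= C.
Hypothesis j_decay : forall z, 1 <= z -> `|j z| <= C * z `^ (- q).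
Hypothesis j'_decay : forall z, 1 <= z -> `|j' z| <= C * z `^ (- q).

Local Notation mu_ := (@lebesgue_measure R).
Local Notation sigma := (mu + nu).
(** Here [q] plays the part of [alpha + 1/2]: it is the decay exponent of [j], and
    [2 q = 2 alpha + 1] is the coefficient in Bessel's equation. *)
Let kappa := nu - 2 * q.
Let c2 := kappa * (nu - 1).

Variables (g : R -> R) (eps r a b : R).
Hypothesis eps0 : 0 <= eps.
Hypothesis r0 : 0 < r.
Hypothesis a0 : 0 < a.
Hypothesis ab : a <= b.
Hypothesis mg : measurable_fun `[a, b] g.
Hypothesis g_le : forall t, a <= t <= b -> `|g t| <= eps * t `^ (mu - 1).

Let cj : continuous j.
Proof. by move=> z; exact: is_derive_continuous (dj z). Qed.

Let cjr t : {for t, continuous (fun t => j (r * t))}.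
Proof. by apply: continuous_comp; [exact: mulrl_continuous|exact: cj]. Qed.

Let pos t : a <= t -> 0 < t. Proof. exact: lt_le_trans. Qed.

Let integrable_powR_bessel e :
  mu_.-integrable `[a, b] (EFin \o (fun t => g t * (t `^ e * j (r * t)))).
Proof.
apply: (@bounded_itv_integrable _ _ _ _ (eps * (a `^ (mu - 1) + b `^ (mu - 1)) *
  ((a `^ e + b `^ e) * 1))).
  apply: measurable_funM => //; apply: measurable_funM.
    by apply: measurable_funTS; exact: measurable_powR.
  by apply: measurable_funTS; apply: continuous_measurable_fun => t; exact: cjr.
move=> t tab; have /andP[at_ tb] := tab; rewrite !normrM.
have t0 := pos at_; rewrite (ger0_norm (powR_ge0 _ _)).
apply: ler_pM => //.
- by rewrite mulr_ge0 ?powR_ge0.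
- by rewrite (le_trans (g_le tab))// ler_wpM2l//; exact: powR_le_ends.
apply: ler_pM => //; [exact: powR_ge0|exact: powR_le_ends|].
by rewrite j_le1// mulr_ge0 ?ltW.
Qed.

(** The integral is at most [eps b^sigma / sigma], and [(r b)^sigma <= 1] absorbs the prefactor. *)
Lemma norm_hankel_head : r * b <= 1 ->
  r `^ sigma * `|\int[mu_]_(t in `[a, b]) (g t * (t `^ nu * j (r * t)))|
  <= eps / sigma.
Proof.
move=> rb.
have h : `|\int[mu_]_(t in `[a, b]) (g t * (t `^ nu * j (r * t)))| <=
    \int[mu_]_(t in `[a, b]) (eps * t `^ (sigma - 1)).
  apply: le_norm_Rintegral => //.
    exact: integrable_ZpowR.
  move=> t tab; have /andP[at_ tb] := tab; rewrite !normrM.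
  have t0 := pos at_; rewrite (ger0_norm (powR_ge0 _ _)) mulrA.
  rewrite -[leRHS]mulr1; apply: ler_pM => //.
  - by rewrite mulr_ge0 ?powR_ge0.
  - rewrite (_ : sigma - 1 = mu - 1 + nu); last by ring.
    by rewrite -powRMD// mulrA ler_wpM2r ?powR_ge0// g_le.
  - by rewrite j_le1// mulr_ge0 ?ltW.
have b0 := lt_le_trans a0 ab.
apply: le_trans (ler_wpM2l (powR_ge0 _ _) h) _.
rewrite RintegralZl//; last exact: integrable_powR.
rewrite Rintegral_powR ?gt_eqF//.
rewrite mulrCA ler_wpM2l//.
rewrite mulrA ler_pdivrMr// mulVf ?gt_eqF//.
apply: (@le_trans _ _ (r `^ sigma * b `^ sigma)).
  by rewrite ler_wpM2l ?powR_ge0// lerBlDr lerDl powR_ge0.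
rewrite -(powRM _ (ltW r0) (ltW b0)) (le_trans (ge0_ler_powR (ltW sigma_gt0) _ _ rb))//.
- by rewrite nnegrE mulr_ge0 ?ltW.
- by rewrite nnegrE.
- by rewrite powR1.
Qed.

Variables (V : R -> R) (I : R).
Hypothesis gV : forall s t, a <= s -> s <= t -> t <= b ->
  `|g t - g s| <= V t - V s.
Hypothesis RSI : is_RS_integral a b (fun t => t `^ (nu - q)) V I.
Hypothesis I_le : I <= eps * a `^ (sigma - q - 1).

Let H t := - r^-1 * (t `^ nu * j' (r * t)) +
  kappa * r ^- 2 * (t `^ (nu - 1) * j (r * t)).
Let h t := t `^ nu * j (r * t) + c2 * r ^- 2 * (t `^ (nu - 2) * j (r * t)).

Let is_derive_H (t : R) : 0 < t -> is_derive t 1 H (h t).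
Proof.
move=> t0; have rt0 : 0 < r * t by rewrite mulr_gt0.
have ? := is_derive1_powR nu t0; have ? := is_derive1_powR (nu - 1) t0.
have dr : is_derive t 1 (fun t => r * t) r.
  by apply: is_derive_eq; rewrite /GRing.scale/=; ring.
have djr : is_derive t 1 (fun t => j (r * t)) (j' (r * t) * r).
  by apply: (@is_derive1_comp _ j (fun t => r * t)).
have dj'r : is_derive t 1 (fun t => j' (r * t))
    ((- j (r * t) - 2 * q / (r * t) * j' (r * t)) * r).
  by have := dj' rt0 => ?; apply: (@is_derive1_comp _ j' (fun t => r * t)).
rewrite /H /h; apply: is_derive_eq; rewrite /GRing.scale/= /c2 /kappa.
rewrite (_ : nu - 1 - 1 = nu - 2); last by ring.
rewrite (powRS nu t0).
by field; rewrite !lt0r_neq0.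
Qed.

Let norm_H t : 1 <= r * t -> 0 < t ->
  `|H t| <= C * (1 + `|kappa|) * r `^ (- q - 1) * t `^ (nu - q).
Proof.
move=> rt t0; rewrite /H; apply: le_trans (ler_normD _ _) _.
have jE (z : R) : `|z| <= C * (r * t) `^ (- q) ->
    `|z| <= C * (r `^ (- q) * t `^ (- q)).
  by rewrite (powRM _ (ltW r0) (ltW t0)).
have {jE}[j'rt jrt] := (jE _ (j'_decay rt), jE _ (j_decay rt)).
(* Since [1 / r <= t], the second term of [H] is of the same size as the first; this gives the
   common factor [1 + |kappa|]. *)
have hr : r ^- 2 <= r^-1 * t.
  by rewrite -exprVn expr2 ler_pM2l ?invr_gt0// -[leLHS]mul1r ler_pdivrMr// mulrC.
rewrite -(powRMD (- q) (-1) r0) -(powRMD nu (- q) t0) (powRS nu t0).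
rewrite (powR_inv1 (ltW r0)).
move: j'rt jrt; rewrite !normrM normrN normfV (gtr0_norm r0).
rewrite !(ger0_norm (powR_ge0 _ _)) (gtr0_norm t0).
rewrite (@ger0_norm _ (r ^- 2)) ?invr_ge0 ?sqr_ge0//.
have := powR_ge0 r (- q); have := powR_ge0 t (- q); have := powR_ge0 t (nu - 1).
move: (r `^ (- q)) (t `^ (- q)) (t `^ (nu - 1)) => X Y Z Z0 Y0 X0 j'rt jrt.
rewrite [leRHS](_ : _ = r^-1 * (Z * t * (C * (X * Y))) +
  `|kappa| * (r^-1 * t) * (Z * (C * (X * Y)))); last by ring.
have r'0 : 0 <= r^-1 by rewrite invr_ge0 ltW.
apply: lerD.
  by apply: ler_wpM2l => //; apply: ler_wpM2l => //; apply: mulr_ge0 => //; exact: ltW.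
apply: ler_pM.
- by rewrite !mulr_ge0 ?invr_ge0 ?sqr_ge0.
- by rewrite mulr_ge0.
- exact: ler_wpM2l.
- exact: ler_wpM2l.
Qed.

(** The 3 counts the two boundary terms and the Stieltjes term. Each is at most
    [eps A a^(sigma - q - 1)], also the one at [b] because the exponent is nonpositive; with
    [r^sigma] and the power of [r] in [A] this becomes a power of [r a >= 1]. The error term yields
    [(r a)^(sigma - q - 2)] in the same way. *)
Lemma norm_hankel_tail : 1 <= r * a ->
  r `^ sigma * `|\int[mu_]_(t in `[a, b]) (g t * (t `^ nu * j (r * t)))|
  <= eps * (3 * (C * (1 + `|kappa|)) + `|c2| * C).
Proof.
move=> ra.
have rt t : a <= t -> 1 <= r * t.
  by move=> at_; rewrite (le_trans ra)// ler_pM2l.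
pose A := C * (1 + `|kappa|) * r `^ (- q - 1).
have A0 : 0 <= A by rewrite !mulr_ge0 ?powR_ge0 ?addr_ge0.
(* This bound on [h] depends on [r], [a] and [b], which is harmless: it serves only to let the mesh
   tend to 0 and is absent from the final estimate. *)
pose K := (a `^ nu + b `^ nu) * 1 +
  `|c2 * r ^- 2| * ((a `^ (nu - 2) + b `^ (nu - 2)) * 1).
have D : by_parts_data g V H h b K a.
  split=> //.
  - by move=> t; rewrite in_itv/= => /andP[/pos t0 _]; exact: is_derive_H.
  - move=> t; rewrite in_itv/= => /andP[/pos t0 _].
    apply: cvgD; first by apply: cvgM; [exact: continuous_powR|exact: cjr].
    apply: cvgM; first exact: cvg_cst.
    by apply: cvgM; [exact: continuous_powR|exact: cjr].
  - move=> t /andP[at_ tb]; apply: le_trans (ler_normD _ _) _.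
    have le_powR_j e : `|t `^ e * j (r * t)| <= (a `^ e + b `^ e) * 1.
      rewrite normrM (ger0_norm (powR_ge0 _ _)); apply: ler_pM => //.
      + exact: powR_ge0.
      + exact: powR_le_ends.
      + by rewrite j_le1// (le_trans _ (rt _ at_)).
    by apply: lerD => //; rewrite normrM; apply: ler_wpM2l.
pose I2 := \int[mu_]_(t in `[a, b]) (g t * (t `^ (nu - 2) * j (r * t))).
have -> : \int[mu_]_(t in `[a, b]) (g t * (t `^ nu * j (r * t))) =
    \int[mu_]_(t in `[a, b]) (g t * h t) - c2 * r ^- 2 * I2.
  have J2 : mu_.-integrable `[a, b] (EFin \o
      (fun t => c2 * r ^- 2 * (g t * (t `^ (nu - 2) * j (r * t))))).
    pose gj t := (g t * (t `^ (nu - 2) * j (r * t)))%:E.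
    rewrite (_ : EFin \o _ = (fun t => (c2 * r ^- 2)%:E * gj t)%E); last exact/funext.
    have gji : mu_.-integrable `[a, b] gj by exact: integrable_powR_bessel.
    exact: integrableZl gji.
  rewrite /I2 -RintegralZl//.
  rewrite -RintegralB//; last exact: by_parts_integrable D.
  by apply: eq_Rintegral => t _; rewrite /h; ring.
have I1_le : `|\int[mu_]_(t in `[a, b]) (g t * h t)| <=
    3 * (eps * (A * a `^ (sigma - q - 1))).
  apply: le_trans (norm_Rintegral_by_parts ab D _ (is_RS_integralZl A RSI)) _.
    by move=> t /andP[at_ tb]; apply: norm_H; [exact: rt|exact: pos].
  have ends t : a <= t -> t <= b ->
      `|g t| * (A * t `^ (nu - q)) <= eps * (A * a `^ (sigma - q - 1)).
    move=> at_ tb; have t0 := pos at_; rewrite mulrCA [leRHS]mulrCA ler_wpM2l//.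
    apply: (@le_trans _ _ (eps * t `^ (mu - 1) * t `^ (nu - q))).
      by rewrite ler_wpM2r ?powR_ge0// g_le// at_.
    rewrite -mulrA powRMD// (_ : mu - 1 + (nu - q) = sigma - q - 1); last by ring.
    by rewrite ler_wpM2l// le0_ler_powR//; move: sigma_le; lra.
  have := ends b ab (lexx b); have := ends a (lexx a) ab.
  have := ler_wpM2l A0 I_le; lra.
have I2_le : `|I2| <= eps * (C * r `^ (- q)) * a `^ (sigma - q - 2).
  apply: (@le_trans _ _ (\int[mu_]_(t in `[a, b])
      (eps * (C * r `^ (- q)) * t `^ (sigma - q - 2 - 1)))).
    apply: le_norm_Rintegral; [exact: integrable_powR_bessel|exact: integrable_ZpowR|].
    move=> t tab; have /andP[at_ tb] := tab; have t0 := pos at_.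
    apply: (@le_trans _ _
      (eps * t `^ (mu - 1) * (t `^ (nu - 2) * (C * (r * t) `^ (- q))))).
      rewrite !normrM; apply: ler_pM => //; first exact: g_le.
      by rewrite (ger0_norm (powR_ge0 _ _)) ler_wpM2l ?powR_ge0// j_decay// rt.
    have -> : sigma - q - 2 - 1 = mu - 1 + (nu - 2) - q by ring.
    rewrite (powRM _ (ltW r0) (ltW t0)) -(powRMD (mu - 1 + (nu - 2)) (- q) t0).
    rewrite -(powRMD (mu - 1) (nu - 2) t0) le_eqVlt; apply/orP; left.
    by apply/eqP; ring.
  rewrite RintegralZl//; last exact: integrable_powR.
  rewrite ler_wpM2l ?mulr_ge0 ?powR_ge0// Rintegral_powR//; last first.
    by apply/eqP; move: sigma_le; lra.
  (* The integral of the power is divided by this exponent; as its modulus is at least 1, the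
     division costs no constant. *)
  have s1 : sigma - q - 2 <= - 1 by move: sigma_le; lra.
  rewrite ler_ndivrMr ?(le_lt_trans s1) ?oppr_lt0//.
  have := ler_wpM2l (powR_ge0 a (sigma - q - 2)) s1.
  have := powR_ge0 b (sigma - q - 2); lra.
apply: le_trans (ler_wpM2l (powR_ge0 _ _) (ler_normB _ _)) _.
rewrite mulrDr mulrDr; apply: lerD.
  apply: le_trans (ler_wpM2l (powR_ge0 _ _) I1_le) _.
  rewrite [leLHS](_ : _ = eps * (3 * (C * (1 + `|kappa|))) *
      (r `^ sigma * r `^ (- q - 1) * a `^ (sigma - q - 1))); last by rewrite /A; ring.
  rewrite -[leRHS]mulr1; apply: ler_wpM2l; first by rewrite !mulr_ge0 ?addr_ge0.
  rewrite powRMD// (_ : sigma + (- q - 1) = sigma - q - 1); last by ring.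
  by rewrite -(powRM _ (ltW r0) (ltW a0)) le0_powR_le1//; move: sigma_le; lra.
apply: (@le_trans _ _ (r `^ sigma * (`|c2| * r ^- 2 *
    (eps * (C * r `^ (- q)) * a `^ (sigma - q - 2))))).
  rewrite ler_wpM2l ?powR_ge0// !normrM (@ger0_norm _ (r ^- 2)) ?invr_ge0 ?sqr_ge0//.
  by rewrite ler_wpM2l// mulr_ge0// invr_ge0 sqr_ge0.
rewrite -(powR_invn 2 (ltW r0)).
rewrite [leLHS](_ : _ = eps * (`|c2| * C) *
  (r `^ sigma * r `^ (- q) * r `^ (- 2%:R) * a `^ (sigma - q - 2))); last by ring.
rewrite -[leRHS]mulr1; apply: ler_wpM2l; first by rewrite !mulr_ge0.
by rewrite !powRMD// -(powRM _ (ltW r0) (ltW a0)) le0_powR_le1//; move: sigma_le; lra.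
Qed.

End hankel_estimates.

(** * Uniform convergence *)

Section uniform_Cauchy.
Variables (R : realType) (T : Type) (E : set T).

Definition uniformly_Cauchy (u : R -> T -> R) := forall e, 0 < e ->
  exists A, forall x, E x -> forall M N, A <= M -> M <= N -> `|u N x - u M x| <= e.

Lemma uniformly_Cauchy_cvg (u : R -> T -> R) : uniformly_Cauchy u ->
  exists l : T -> R, forall e, 0 < e ->
    exists A, forall x, E x -> forall N, A <= N -> `|l x - u N x| <= e.
Proof.
move=> uC; exists (fun x => lim (u N x @[N --> +oo])) => e e0.
have [A hA] := uC _ e0; exists A => x Ex N AN.
have /cvgrPdist_le ul : cvg (u N x @[N --> +oo]).
  apply/cauchy_cvgP/cauchy_exP => d d0.
  have [B hB] := uC _ (divr_gt0 d0 (ltr0Sn _ 1)); exists (u B x).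
  suff: \forall M \near +oo, ball (u B x) d (u M x) by [].
  near=> M; have BM : B <= M by near: M; apply: nbhs_pinfty_ge; exact: num_real.
  rewrite -ball_normE/= distrC.
  apply: le_lt_trans (hB _ Ex _ _ (lexx B) BM) _.
  by rewrite gtr_pMr// invf_lt1// ltr1n.
apply/ler_addgt0Pr => d d0; have := ul _ d0 => ud.
near (pinfty_nbhs R)%R => M.
have NM : N <= M by near: M; apply: nbhs_pinfty_ge; exact: num_real.
have := hA _ Ex _ _ AN NM; have : `|lim (u N x @[N --> +oo]) - u M x| <= d.
  by near: M.
have := ler_normD (lim (u N x @[N --> +oo]) - u M x) (u M x - u N x).
by rewrite addrA subrK; lra.
Unshelve. all: by end_near. Qed.

End uniform_Cauchy.

Lemma complex_norm_le (R : realType) (z : R[i]) :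
  `|z| <= (`|complex.Re z| + `|complex.Im z|)%:C.
Proof.
rewrite normc_def lecR -[leRHS]ger0_norm ?addr_ge0// -sqrtr_sqr ler_wsqrtr//.
rewrite sqrrD !real_normK ?num_real// lerD2r lerDl.
by rewrite mulrn_wge0// mulr_ge0.
Qed.

Lemma uniformly_Cauchy_complex (R : realType) (E : set R) (F : R -> R -> R[i]^o)
    (u v : R -> R -> R) :
  (forall N x, F N x = u N x +i* v N x) ->
  uniformly_Cauchy E u -> uniformly_Cauchy E v ->
  {uniform E, F @ +oo --> (fun x => lim (F N x @[N --> +oo]) : R[i]^o)}.
Proof.
move=> FE /uniformly_Cauchy_cvg[k uk] /uniformly_Cauchy_cvg[l vl].
have Fkl (e : R[i]) : 0 < e -> exists A : R, forall x, E x -> forall N, A <= N ->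
    `|(k x +i* l x : R[i]^o) - F N x| < e.
  (* A positive element of [R[i]] has imaginary part 0, so the tolerance is real. *)
  case: e => e e'; rewrite ltcE/= => /andP[/eqP -> e0].
  have e30 : 0 < e / 3 by rewrite divr_gt0.
  have [[A hA] [B hB]] := (uk _ e30, vl _ e30).
  exists (Num.max A B) => x Ex N; rewrite ge_max => /andP[AN BN].
  rewrite FE; apply: (le_lt_trans (complex_norm_le _)).
  by rewrite ltcR/=; have := hA _ Ex _ AN; have := hB _ Ex _ BN; lra.
(* The limit is identified on [E] only, which is all that uniform convergence on [E] tests. *)
have limF x : E x -> lim (F N x @[N --> +oo]) = (k x +i* l x : R[i]^o).
  move=> Ex; apply: cvg_lim; first exact: norm_hausdorff.
  apply/cvgrPdist_lt => e /Fkl[A hA]; near=> N.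
  have AN : A <= N by near: N; apply: nbhs_pinfty_ge; exact: num_real.
  exact: hA.
move=> P /uniform_nbhs[W []]; rewrite -entourage_ballE => -[e /= e0 eW] WP.
have [A hA] := Fkl _ e0.
suff: \forall N \near +oo, P (F N) by [].
near=> N; have AN : A <= N by near: N; apply: nbhs_pinfty_ge; exact: num_real.
apply: WP => x Ex /=; apply: eW.
by rewrite /= -ball_normE /= limF//; exact: hA.
Unshelve. all: by end_near. Qed.

(** Passes from integrability on the open interval []0, 1[] to the closed intervals [[0, N]] of the
    partial integrals: end points have measure 0. *)
Lemma integrable_itv_cat (R : realType) (f : R -> R) (a b c : R) :
  a <= b -> b <= c ->
  lebesgue_measure.-integrable `]a, b[ (EFin \o f) ->
  lebesgue_measure.-integrable `[b, c] (EFin \o f) ->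
  lebesgue_measure.-integrable `[a, c] (EFin \o f).
Proof.
rewrite le_eqVlt => /predU1P[->//|ab] bc /integrableP[mf1 if1] /integrableP[mf2 if2].
have mf1' : measurable_fun `[a, b[ (EFin \o f).
  exact/emeasurable_fun_itv_obnd_cbndP.
have acE : (`[a, c] = `[a, b[ `|` `[b, c])%classic.
  by apply: itv_bndbnd_setU; rewrite bnd_simp// ltW.
have mf : measurable_fun `[a, c] (EFin \o f) by rewrite acE measurable_funU.
apply/integrableP; split=> //; move: mf; rewrite acE => mf.
rewrite ge0_integral_setU//=; last 2 first.
- by apply/measurable_EFinP/measurableT_comp => //; exact/measurable_EFinP.
- rewrite disj_set2E; apply/eqP/seteqP; split=> x//=.
  rewrite !in_itv/= => -[/andP[_ xb] /andP[bx _]].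
  by move: (lt_le_trans xb bx); rewrite ltxx.
rewrite lte_add_pinfty// -integral_itv_obnd_cbnd//.
by apply/measurable_EFinP/measurableT_comp => //; exact/measurable_EFinP.
Qed.

Section component.
Variables (R : realType) (alpha nu mu : R) (f : R -> R[i]) (pr : R[i] -> R).
Hypothesis pr_le : forall z, `|pr z| <= normc z.
Hypothesis prB : forall z w, pr (z - w) = pr z - pr w.
Hypothesis prZ : forall (x y : R) z, pr (x%:C * z * y%:C) = x * pr z * y.

Hypothesis halpha : - 2^-1 <= alpha.
Hypothesis hmunu_gt0 : 0 < mu + nu.
Hypothesis hmunu_le : mu + nu <= alpha + 3 / 2.
Hypothesis hBV : clocally_BV_pos f.
Hypothesis hloc : locally_integrable `]0, +oo[ (pr \o f).
Hypothesis hL1 : lebesgue_measure.-integrable `]0, 1[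
  (fun t => (pr ((t `^ nu)%:C * f t))%:E).
Hypothesis small_tail : forall eps, 0 < eps -> exists2 A, 1 <= A &
  forall t, A <= t -> normc (f t) <= eps * t `^ (mu - 1) /\
    (variation_integral_infty t (fun t => t `^ (nu - alpha - 1 / 2))%R f
      <= (eps * t `^ (mu + nu - alpha - 3 / 2))%:E)%E.

Local Notation m := (@lebesgue_measure R).

Let g t := pr (f t).

Let measurable_g (a b : R) : 0 < a -> measurable_fun `[a, b] g.
Proof.
move=> a0; case: hloc => mg _ _; apply: measurable_funS mg => //.
by move=> t /=; rewrite !in_itv/= andbT => /andP[/(lt_le_trans a0)].
Qed.

Let integrable_g (a b : R) : 0 < a -> m.-integrable `[a, b] (EFin \o g).
Proof.
move=> a0; case: hloc => _ _ lg; apply/integrableP; split.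
  by apply/measurable_EFinP; exact: measurable_g.
have := lg `[a, b]%classic _ (@segment_compact _ a b); apply.
by move=> t /=; rewrite !in_itv/= andbT => /andP[/(lt_le_trans a0)].
Qed.

Let prZ1 (x : R) z : pr (x%:C * z) = x * pr z.
Proof. by have := prZ x 1 z; rewrite !mulr1. Qed.

(** [pr] is the real or the imaginary part. Being dominated by the modulus, both have increments
    controlled by the total variation of the complex function [f], so one argument serves twice. *)
Lemma component_uniformly_Cauchy :
  uniformly_Cauchy [set r | 0 <= r] (fun N r => r `^ (mu + nu) *
    \int[m]_(t in `[0, N])
      pr ((t `^ nu)%:C * f t * (besselj alpha (r * t))%:C)).
Proof.
have [j [j' [bE dj dj' cj' [j0 j'0]]]] := besselj_ode halpha.
have p0 : 0 <= 2 * alpha + 1 by move: halpha; lra.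
have [C C0 dec] := bessel_decay p0 dj dj' cj' j0 j'0.
have j_le1 := bessel_le1 p0 dj dj' cj' j0 j'0.
have cj : continuous j by move=> z; exact: is_derive_continuous (dj z).
pose q := alpha + 2^-1.
have q2 : (2 * alpha + 1) / 2 = q by rewrite /q; lra.
have dec1 (z : R) : 1 <= z -> `|j z| <= C * z `^ (- q) by move=> /dec[+ _]; rewrite q2.
have dec2 (z : R) : 1 <= z -> `|j' z| <= C * z `^ (- q) by move=> /dec[_ +]; rewrite q2.
have sq : mu + nu <= q + 1 by move: hmunu_le; rewrite /q; lra.
have dj'q (z : R) : 0 < z -> is_derive z 1 j' (- j z - 2 * q / z * j' z).
  move=> /dj'; rewrite (_ : 2 * q = 2 * alpha + 1)//.
  by rewrite /q; lra.
have integrable_partial (r N : R) : 0 < r -> 1 <= N -> m.-integrable `[0, N] (EFin \o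
    (fun t => pr ((t `^ nu)%:C * f t * (besselj alpha (r * t))%:C))).
  move=> r0 N1; have bj (D : set R) : D `<=` [set t | 0 <= t] ->
      [bounded j (r * t) | t in D].
    move=> D0; exists 1; split; first exact: num_real.
    move=> x x1 t Dt; apply: le_trans (ltW x1); apply: j_le1.
    by rewrite mulr_ge0 ?(ltW r0)//; exact: D0.
  have mj (D : set R) : measurable_fun D (fun t => j (r * t)).
    apply: measurable_funTS; apply: continuous_measurable_fun => t.
    by apply: continuous_comp; [exact: mulrl_continuous|exact: cj].
  (* Near 0 a bounded factor [j] multiplies the integrable [t^nu f]; on [[1, N]] a bounded kernel
     multiplies the locally integrable [f]. The open end keeps out [t = 0], where [j] and [besselj]
     may differ. *)
  apply: (@integrable_itv_cat _ _ _ 1) => //.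
    apply: eq_integrable (integrableMl _ hL1 (mj _) (bj `]0, 1[%classic _)) => //.
      move=> t; rewrite inE/= in_itv/= => /andP[t0 _].
      by rewrite prZ -prZ1 bE ?mulr_gt0.
    by move=> t/=; rewrite in_itv/= => /andP[/ltW].
  have gE : {in `[1, N]%classic,
      ((EFin \o g) \* (EFin \o (fun t => t `^ nu * j (r * t))%R))%E
      =1 EFin \o (fun t => pr ((t `^ nu)%:C * f t * (besselj alpha (r * t))%:C))}.
    move=> t; rewrite inE/= in_itv/= => /andP[/(lt_le_trans ltr01) t0 _].
    by rewrite -EFinM prZ bE ?mulr_gt0// /g; congr (_%:E); ring.
  refine (@eq_integrable _ _ _ m _ _ _ _ gE _) => //.
  apply: (integrableMl _ (integrable_g _ ltr01)) => //.
    apply: measurable_funM; last exact: mj.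
    by apply: measurable_funTS; exact: measurable_powR.
  exists ((1 `^ nu + N `^ nu) * 1); split; first exact: num_real.
  move=> x x1 t; rewrite /= in_itv/= => /andP[t1 tN]; apply: le_trans (ltW x1).
  rewrite normrM (ger0_norm (powR_ge0 _ _)); apply: ler_pM => //.
  - exact: powR_ge0.
  - exact: powR_le_ends.
  - by rewrite j_le1// mulr_ge0 ?(ltW r0)// (le_trans ler01).
pose K := 3 * (C * (1 + `|nu - 2 * q|)) + `|(nu - 2 * q) * (nu - 1)| * C.
have K0 : 0 <= K by rewrite addr_ge0 ?mulr_ge0// addr_ge0.
(* The sum of the head and tail constants: with [eps = e / D] the two pieces add up to [e]. *)
pose D := (mu + nu)^-1 + K.
have D0 : 0 < D.
  by rewrite ltr_pwDl ?invr_gt0.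
move=> e e0; have [A A1 hA] := small_tail (divr_gt0 e0 D0).
(* At [r = 0] the factor [r^(mu + nu)] vanishes because the exponent is positive. *)
exists A => r /=; rewrite le_eqVlt => /predU1P[<-|r0] M N AM MN.
  by rewrite powR0 ?gt_eqF// !mul0r subrr normr0 ltW.
have M1 := le_trans A1 AM; have M0 := lt_le_trans ltr01 M1.
have N1 := le_trans M1 MN.
rewrite -mulrBr normrM (ger0_norm (powR_ge0 _ _)).
rewrite (Rintegral_itv_split (ltW M0) MN (integrable_partial _ _ r0 N1)).
rewrite addrAC subrr add0r.
have jE : {in `[M, N]%classic,
    (fun t => pr ((t `^ nu)%:C * f t * (besselj alpha (r * t))%:C))
    =1 (fun t => g t * (t `^ nu * j (r * t)))}.
  move=> t; rewrite inE/= in_itv/= => /andP[/(lt_le_trans M0) t0 _].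
  by rewrite prZ bE ?mulr_gt0// /g; ring.
pose J (a b : R) := \int[m]_(t in `[a, b]) (g t * (t `^ nu * j (r * t))).
have -> : \int[m]_(t in `[M, N])
    pr ((t `^ nu)%:C * f t * (besselj alpha (r * t))%:C) = J M N.
  exact: eq_Rintegral.
have -> : e = e / D / (mu + nu) + e / D * K.
  by rewrite -mulrDr -/D divfK// gt_eqF.
have eD0 : 0 <= e / D by rewrite divr_ge0 ?ltW.
have g_le (a b : R) : M <= a ->
    forall t, a <= t <= b -> `|g t| <= e / D * t `^ (mu - 1).
  move=> Ma t /andP[at_ _]; apply: le_trans (pr_le _) _.
  by have [] := hA t (le_trans AM (le_trans Ma at_)).
have head (a b : R) : M <= a -> a <= b -> r * b <= 1 ->
    r `^ (mu + nu) * `|J a b| <= e / D / (mu + nu).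
  move=> Ma ab rb; have a0 := lt_le_trans M0 Ma.
  exact: (norm_hankel_head hmunu_gt0 dj j_le1 eD0 r0 a0 ab
    (measurable_g a0) (g_le _ _ Ma) rb).
have tail (a b : R) : M <= a -> a <= b -> 1 <= r * a ->
    r `^ (mu + nu) * `|J a b| <= e / D * K.
  move=> Ma ab ra; have a0 := lt_le_trans M0 Ma.
  have gV (s t : R) : a <= s -> s <= t -> t <= b -> `|g t - g s| <=
      fine (ctotal_variation a t f) - fine (ctotal_variation a s f).
    move=> as_ st _; rewrite -prB; apply: le_trans (pr_le _) _.
    exact: normc_le_ctotal_variation.
  have RSI := is_RS_variation_integral (nu - q) hBV a0 ab.
  apply: (norm_hankel_tail sq dj dj'q j_le1 C0 dec1 dec2 eD0 r0 a0 ab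
    (measurable_g a0) (g_le _ _ Ma) gV RSI _ ra).
  (* The tail begins at [a = M] or at [a = 1/r >= M], beyond [A] in both cases, so the smallness
     hypothesis is applied at [a] itself. *)
  have [_] := hA a (le_trans AM Ma).
  rewrite (_ : nu - alpha - 1 / 2 = nu - q); last by rewrite /q; lra.
  rewrite (_ : mu + nu - alpha - 3 / 2 = mu + nu - q - 1); last by rewrite /q; lra.
  rewrite -lee_fin; apply: le_trans.
  exact: le_variation_integral_infty.
have T0 : 0 <= e / D / (mu + nu) by rewrite divr_ge0// ltW.
have T1 : 0 <= e / D * K by rewrite mulr_ge0.
have [rN|rN] := leP (r * N) 1.
  by rewrite (le_trans (head M N (lexx _) MN rN))// lerDl.
have [rM|rM] := leP 1 (r * M).
  by rewrite (le_trans (tail M N (lexx _) MN rM))// lerDr.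
have Mr : M <= r^-1 by rewrite -[leRHS]mul1r ler_pdivlMr// mulrC ltW.
have rN' : r^-1 <= N by rewrite -[leLHS]mul1r ler_pdivrMr// mulrC ltW.
have rr : r * r^-1 = 1 by rewrite mulfV// gt_eqF.
have -> : J M N = J M r^-1 + J r^-1 N.
  apply: Rintegral_itv_split => //.
  have JE : {in `[M, N]%classic,
      EFin \o (fun t => pr ((t `^ nu)%:C * f t * (besselj alpha (r * t))%:C))
      =1 EFin \o (fun t => g t * (t `^ nu * j (r * t)))}.
    by move=> t tMN; rewrite /= jE.
  refine (@eq_integrable _ _ _ m _ _ _ _ JE _) => //.
  exact: integrable_itvS (ltW M0) (lexx N) (integrable_partial _ _ r0 N1).
apply: le_trans (ler_wpM2l (powR_ge0 _ _) (ler_normD _ _)) _.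
by rewrite mulrDr lerD//; [apply: head|apply: tail] => //; rewrite rr.
Qed.

End component.

Lemma near_pinftyP (R : realType) (P : R -> Prop) :
  (\forall t \near +oo, P t) -> exists2 A, 1 <= A & forall t, A <= t -> P t.
Proof.
move=> [A [_ AP]]; exists (Num.max 1 (A + 1)); first by rewrite le_max lexx.
move=> t; rewrite ge_max => /andP[_ At]; apply: AP.
by rewrite (lt_le_trans _ At)// ltrDl.
Qed.

Theorem theorem1p2 (R : realType) (alpha nu mu : R) (f : R -> R[i])
  (halpha : - 2^-1 <= alpha)
  (hmunu_gt0 : 0 < mu + nu)
  (hmunu_le : mu + nu <= alpha + 3 / 2)
  (hBV : clocally_BV_pos f)
  (hloc : clocally_integrable `]0, +oo[ f)
  (hL1 : cintegrable `]0, 1[ (fun t => (t `^ nu)%:C * f t))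
  (hf : (fun M : R => normc (f M)) =o_ (pinfty_nbhs R) (fun M : R => M `^ (mu - 1)))
  (hdf_fin : \forall M \near +oo,
     variation_integral_infty M (fun t => t `^ (nu - alpha - 1 / 2)) f
       \is a fin_num)
  (hdf : (fun M : R =>
            fine (variation_integral_infty M
                    (fun t => t `^ (nu - alpha - 1 / 2)) f))
         =o_ (pinfty_nbhs R) (fun M : R => M `^ (mu + nu - alpha - 3 / 2))) :
  hankel_converges_uniformly alpha nu mu f [set r | 0 <= r].
Proof.
move: hf hdf => /eqoP hf /eqoP hdf.
have small eps : 0 < eps -> exists2 A, 1 <= A & forall t, A <= t ->
    normc (f t) <= eps * t `^ (mu - 1) /\
    (variation_integral_infty t (fun t => t `^ (nu - alpha - 1 / 2))%R f
      <= (eps * t `^ (mu + nu - alpha - 3 / 2))%:E)%E.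
  move=> eps0; apply: near_pinftyP; near=> t; split.
    have : `|normc (f t)| <= eps * `|t `^ (mu - 1)| by near: t; exact: hf.
    by rewrite !ger0_norm ?powR_ge0 ?normc_ge0.
  (* Finiteness allows [fine] to be undone; an infinite variation integral would be read as 0 by the
     little-o condition. *)
  have vfin : variation_integral_infty t (fun t => t `^ (nu - alpha - 1 / 2)) f
    \is a fin_num by near: t.
  have vle : `|fine (variation_integral_infty t (fun t => t `^ (nu - alpha - 1 / 2)) f)|
      <= eps * `|t `^ (mu + nu - alpha - 3 / 2)| by near: t; exact: hdf.
  rewrite -(fineK vfin) lee_fin (le_trans (ler_norm _))//.
  by rewrite (ger0_norm (powR_ge0 t _)) in vle.
have [hlocRe hlocIm] := hloc; have [hL1Re hL1Im] := hL1.
apply: uniformly_Cauchy_complex; last 2 first.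
- apply: (@component_uniformly_Cauchy _ alpha nu mu f (@complex.Re R)) => //.
  + exact: Re_normc_le.
  + by case=> x y [].
  + by move=> x y [z w] /=; ring.
- apply: (@component_uniformly_Cauchy _ alpha nu mu f (@complex.Im R)) => //.
  + exact: Im_normc_le.
  + by case=> x y [].
  + by move=> x y [z w] /=; ring.
move=> N r; rewrite /hankel_partial /cintegral.
by congr (_ +i* _); rewrite mul0r ?subr0 ?addr0.
Unshelve. all: by end_near. Qed.
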